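(* Let $\beta>0$, $\mu\in\mathcal{P}_2^r(X)$, and let $(\mathbf{X}_t)_{t\ge0}$ be the Ornstein–Uhlenbeck process $d\mathbf{X}_t=-\mathbf{X}_t\,dt+\sqrt{2\beta^{-1}}\,d\mathbf{B}_t$ with $\mathbf{X}_0\sim\mu$; let $\mu_t$ be the law of $\mathbf{X}_t$, so that $\mathbf{X}_t\overset{d}{=}e^{-t}\mathbf{X}_0+\sqrt{\beta^{-1}(1-e^{-2t})}\,\mathbf{Z}$ with $\mathbf{Z}\sim\mathcal{N}(0,I_d)$ independent. Fix $t>0$, set $\mathsf r(t):=\frac{e^{-t}}{\sqrt{\beta^{-1}(1-e^{-2t})}}$, and define the backward map $\mathbf{b}^{\mu,\eta}:=\mathrm{id}+\eta(\mathrm{id}+\beta^{-1}\nabla\log p_{\mu_t})$. Then for every $M\ge1$ and every $\delta\in(0,1]$, $$\limsup_{\eta\to0}\ \limsup_{\nu\in\mathcal{M}(\mu_t,M):\,\nu\xrightarrow{W_2}\mu_t}\ \frac{1}{\eta}\,\frac{W_2^2(\mathbf{b}^{\mu,\eta}_\#\mu_t,\mathbf{b}^{\mu,\eta}_\#\nu)-W_2^2(\mu_t,\nu)}{W_2^2(\mu_t,\nu)}\le 2-\frac{2}{1-e^{-2t}}\Big[\delta-M\cdot h_\mu(\delta,\mathsf r(t))\Big].$$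
   Context: $\mathcal{P}_2^r(X)$ denotes probability measures on $X\subseteq\mathbb{R}^d$ with finite second moment, absolutely continuous w.r.t. Lebesgue measure; $p_\nu$ is the density of $\nu$; $W_2$ the Wasserstein-2 distance; $\mathbf{T}_\#\mu$ pushforward; $\mathrm{id}$ the identity. For $\mu,\nu\in\mathcal{P}_2^r(X)$, $\mathbf{t}^{\nu}_{\mu}$ denotes the optimal transport (Brenier) map pushing $\mu$ to $\nu$. For $M\ge1$, $\mathcal{M}(\mu,M):=\{\nu\in\mathcal{P}_2^r(X): \sup_{x\in\mathrm{Dom}(\mu)}\|\mathbf{t}^\nu_\mu(x)-x\|^2\le M\int\|\mathbf{t}^\nu_\mu(x)-x\|^2d\mu(x)\}$. For SNR $\mathsf r\ge0$, let $\mathbf{Y}_{\mathsf r}:=\mathsf r\mathbf{X}+\mathbf{Z}$ with $\mathbf{X}\sim\mu$, $\mathbf{Z}\sim\mathcal{N}(0,I_d)$ independent; $L_{\mathsf r}(y)=\|\mathrm{Cov}[\mathsf r\mathbf{X}\mid\mathbf{Y}_{\mathsf r}=y]\|_{op}$, $\mathbf{L}_{\mathsf r}=L_{\mathsf r}(\mathbf{Y}_{\mathsf r})$, $s_{\mathsf r}(u)=\mathbb{P}(\mathbf{L}_{\mathsf r}>u)$, and $h_\mu(\delta,\mathsf r):=\int_{1-\delta}^\infty s_{\mathsf r}(u)\,du$. *)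

(* Defs.v *)
From HB Require Import structures.
From mathcomp Require Import all_boot all_order all_algebra.
From mathcomp Require Import all_classical all_reals all_analysis.
Set Implicit Arguments. Unset Strict Implicit. Unset Printing Implicit Defensive.
Import Order.TTheory GRing.Theory Num.Theory.
Import numFieldNormedType.Exports.
Local Open Scope classical_set_scope.
Local Open Scope ring_scope.

(* R^d is represented by row vectors 'rV[R]_d; [Rd R d] is the same carrier   *)
(* equipped with its Borel sigma-algebra (generated by the open sets of the   *)
(* usual (product = Euclidean) topology).                                     *)
Definition Rd (R : realType) (d : nat) :=
  g_sigma_algebraType (@open 'rV[R]_d).

Section defs.
Context {R : realType} {d : nat}.
Local Notation V := 'rV[R]_d.
Local Notation B := (Rd R d).

Definition sqn (v : V) : R := \sum_i (v 0 i) ^+ 2.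

Definition setcoord (x : V) (k : nat) (s : R) : V :=
  \row_j (if (j : nat) == k then s else x 0 j).

(* Integral w.r.t. Lebesgue measure on R^d of a nonnegative function,        *)
(* computed as the iterated (Tonelli) integral of 1-d Lebesgue integrals.    *)
Fixpoint iter_leb (k : nat) (f : V -> \bar R) (x : V) : \bar R :=
  match k with
  | 0 => f x
  | k.+1 => (\int[@lebesgue_measure R]_s iter_leb k f (setcoord x k s))%E
  end.

Definition leb_int (f : V -> \bar R) : \bar R := iter_leb d f 0.

Definition is_density (nu : set B -> \bar R) (p : V -> R) : Prop :=
  (forall x, 0 <= p x) /\ measurable_fun [set: B] (p : B -> R) /\
  forall A : set B, measurable A ->
    nu A = leb_int (fun x => (p x * \1_A x)%:E).

Definition P2r (nu : probability B R) : Prop :=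
  (exists p, is_density nu p) /\ (\int[nu]_x (sqn x)%:E < +oo)%E.

Definition gauss (s : R) (z : V) : R :=
  (Num.sqrt (2 * pi * s ^+ 2))^-1 ^+ d * expR (- sqn z / (2 * s ^+ 2)).

Definition push (f : V -> V) (nu : set B -> \bar R) : set B -> \bar R :=
  fun A => nu (f @^-1` A).

Definition coupling (mu nu : set B -> \bar R)
    (g : probability (B * B)%type R) : Prop :=
  forall A : set B, measurable A ->
    g (A `*` setT) = mu A /\ g (setT `*` A) = nu A.

Definition W2sq (mu nu : set B -> \bar R) : \bar R :=
  ereal_inf [set (\int[g]_z (sqn ((z.1 : V) - (z.2 : V)))%:E)%E
            | g in [set g | coupling mu nu g]].

Definition Mset (mu : probability B R) (M : R) (nu : probability B R) : Prop :=
  P2r nu /\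
  exists T : V -> V,
    measurable_fun [set: B] (T : B -> B) /\
    (forall A : set B, measurable A -> nu A = mu (T @^-1` A)) /\
    (\int[mu]_x (sqn (T x - x))%:E)%E = W2sq mu nu /\
    {ae mu, forall x : B, ((sqn (T x - x))%:E <= M%:E * W2sq mu nu)%E}.

Definition grad (f : V -> R) (x : V) : V :=
  \row_i derive f x (delta_mx 0 i).

Definition bmap (beta : R) (p : V -> R) (eta : R) (x : V) : V :=
  x + eta *: (x + beta^-1 *: grad (fun y => ln (p y)) x).

(* Gaussian channel Y_r = r X + Z, X ~ mu, Z ~ N(0, I_d):                    *)
(* posterior expectation E[g(X) | Y_r = y] (regular version)                  *)
Definition postw (r : R) (y x : V) : R := expR (- sqn (y - r *: x) / 2).

Definition postE (mu : probability B R) (r : R) (y : V) (g : V -> R) : R :=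
  (\int[mu]_x (g x * postw r y x)) / (\int[mu]_x postw r y x).

Definition condcov (mu : probability B R) (r : R) (y : V) : 'M[R]_d :=
  \matrix_(i, j)
    (postE mu r y (fun x => (r * x 0 i) * (r * x 0 j))
     - postE mu r y (fun x => r * x 0 i) * postE mu r y (fun x => r * x 0 j)).

Definition opnorm (A : 'M[R]_d) : R :=
  sup [set Num.sqrt (sqn (u *m A)) | u in [set u : V | sqn u = 1]].

Definition Lr (mu : probability B R) (r : R) (y : V) : R :=
  opnorm (condcov mu r y).

(* s_r(u) = P(L_r(Y_r) > u) *)
Definition s_r (mu : probability B R) (r u : R) : \bar R :=
  (\int[mu]_x leb_int (fun z =>
     (gauss 1 z * \1_[set y | u < Lr mu r y] (r *: (x : V) + z))%:E))%E.

Definition h_mu (mu : probability B R) (delta r : R) : \bar R :=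
  (\int[@lebesgue_measure R]_(u in [set u : R | (1 - delta <= u)%R]) s_r mu r u)%E.

Definition OU_law (beta t : R) (mu : probability B R) : set B -> \bar R :=
  fun A => (\int[mu]_y leb_int (fun z =>
     (gauss 1 z * \1_A (expR (- t) *: (y : V)
                       + Num.sqrt (beta^-1 * (1 - expR (- (2 * t)))) *: z))%:E))%E.

Definition snr (beta t : R) : R :=
  expR (- t) / Num.sqrt (beta^-1 * (1 - expR (- (2 * t)))).

Definition ratio (b : V -> V) (eta : R) (mut nu : probability B R) : \bar R :=
  ((W2sq (push b mut) (push b nu) - W2sq mut nu)
   * ((eta * fine (W2sq mut nu))^-1)%:E)%E.

Definition inner_limsup (b : V -> V) (eta : R) (mut : probability B R) (M : R)
  : \bar R :=
  ereal_inf [set ereal_sup [set ratio b eta mut nu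
      | nu in [set nu : probability B R |
               Mset mut M nu /\ (0 < W2sq mut nu < eps%:E)%E]]
    | eps in [set e : R | 0 < e]].

Definition eta_limsup (G : R -> \bar R) : \bar R :=
  ereal_inf [set ereal_sup [set G eta | eta in [set e : R | 0 < e < eps]]
    | eps in [set e : R | 0 < e]].

End defs.

(* Main.v *)
(** Write sigma^2 = beta^-1 (1 - e^(-2t)) and r = snr beta t.  The density of
    mu_t is proportional to Q(y / sigma), where Q is the evidence
    Q(y) = int exp(-|y - r x|^2 / 2) mu(dx), so the drift of the backward map is
    x + (sigma m(x / sigma) - x) / (1 - e^(-2t)) with m the posterior mean of
    r X, and the derivative of m is the posterior covariance.  Pushing the
    optimal map T from mu_t to nu through (b, b o T) gives a coupling; as
    |T x - x|^2 <= M W_2^2 almost everywhere, the mean value theorem bounds its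
    cost by the local supremum of the operator norm L over balls that shrink
    with W_2(mu_t, nu).  Continuity of L and dominated convergence turn the
    local supremum into L, and the layer cake formula turns
    E(L - (1 - delta))_+ into h_mu.

    The second-order term in eta, and the domination, need E sup L^2 < oo from
    a second moment only.  This comes from L <= 4 d log(1/Q),
    Q(y + xi) >= exp(-|xi|^2) Q(y)^2, and the finiteness of
    int Q log^2 Q. *)

Require Import Defs.
From HB Require Import structures.
From mathcomp Require Import all_boot all_order all_algebra.
From mathcomp Require Import all_classical all_reals all_analysis.
From mathcomp Require Import measurable_realfun ring lra.
Set Implicit Arguments.
Unset Strict Implicit.
Unset Printing Implicit Defensive.
Import Order.TTheory GRing.Theory Num.Theory.
Import numFieldNormedType.Exports.
Local Open Scope classical_set_scope.
Local Open Scope ring_scope.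

(** * Borel sets of R^d *)

Section borel.
Context {R : realType} {d : nat}.
Local Notation V := 'rV[R]_d.
Local Notation B := (Rd R d).

(** The threshold [1 - delta] splits L into a constant and an excess. The constant multiplies the
    transport cost itself and joins the linear part of the drift: with lam = 1 / (1 - e^(-2t)), the
    rate is 1 - lam + lam (1 - delta) = 1 - lam delta. The excess varies with x, and the
    displacement T x - x may concentrate where it is large; the essential bound in [Mset] controls
    the product of the two, so in the limit M multiplies h_mu alone.

    The evidence is, up to scale, the density of mu_t itself. A point of large loss therefore has
    small density, and this exponential smallness takes the place of higher moments of mu.

    The law mu_t is given by its values on sets, and densities by iterated integrals. Integrals of
    functions are moved between these descriptions by inequalities in one direction, which is enough
    for upper bounds; the only iterated integrals computed exactly are those of products over the
    coordinates. *)

Lemma open_measurable_Rd (U : set V) : open U -> measurable (U : set B).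
Proof. exact: sub_sigma_algebra. Qed.

Lemma continuous_measurable_Rd (f : V -> R) :
  continuous f -> measurable_fun [set: B] (f : B -> R).
Proof.
move=> /continuousP cf; apply: (measurability _ (RGenOInfty.measurableE R)).
move=> _ [_ [a ->] <-]; rewrite setTI.
by apply: open_measurable_Rd; apply: cf; exact: interval_open.
Qed.

Lemma measurable_coord i : measurable_fun [set: B] (fun x : B => (x : V) 0 i).
Proof. by apply: continuous_measurable_Rd; exact: coord_continuous. Qed.

(** The sigma-algebra of [Rd] is generated by all open sets, not by the coordinates. Boxes with
    rational centre and radius form a countable base, which reduces measurability of a vector-valued
    map to its coordinates. *)
Let ratbox (cr : 'rV[rat]_d * rat) : set V :=
  [set y | forall i, `|y 0 i - ratr (cr.1 0 i)| < ratr cr.2].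

Let open_ratbox (U : set V) : open U ->
  U = \bigcup_(cr in [set cr | ratbox cr `<=` U]) ratbox cr.
Proof.
move=> oU; apply/seteqP; split => [x Ux|x [cr /= sub] /sub//].
have /nbhs_ballP[e /= e0 eU] : nbhs x U by exact: open_nbhs_nbhs.
(* With radius below e / 2 and centre within that radius of x, every point of the box is within e of
   x. *)
have [r] := @rat_in_itvoo R 0 (e / 2) ltac:(by rewrite divr_gt0).
rewrite in_itv/= => /andP[r0 re].
have cP i : {q : rat | `|x 0 i - ratr q| < ratr r}.
  apply: cid.
  have [q] := @rat_in_itvoo R (x 0 i - ratr r) (x 0 i + ratr r)
    ltac:(by rewrite ltrD2l gtrN).
  rewrite in_itv/= => /andP[q1 q2]; exists q.
  by rewrite ltr_norml; apply/andP; split; lra.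
exists (\row_i sval (cP i), r) => /=; last first.
  by move=> i /=; rewrite mxE; exact: svalP (cP i).
move=> y /= yr; apply: eU; split => // i j; rewrite (ord1 i).
have := yr j; have := svalP (cP j); rewrite /= mxE => h1 h2.
rewrite /ball/= -(subrK (ratr (sval (cP j))) (x 0 j)) -addrA.
rewrite (le_lt_trans (ler_normD _ _))// [ltRHS](splitr e).
by rewrite ltrD//; [exact: lt_trans h1 re|rewrite distrC; exact: lt_trans h2 re].
Qed.

Lemma measurable_fun_Rd dX (X : measurableType dX) (g : X -> V) :
  (forall i, measurable_fun [set: X] (fun x => g x 0 i)) ->
  measurable_fun [set: X] (g : X -> B).
Proof.
move=> mg; refine (@measurability _ _ _ B _ _ (@open V) erefl _).
move=> _ [U oU <-]; rewrite setTI (open_ratbox oU) preimage_bigcup.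
rewrite bigcup_mkcond; apply: countable_bigcupT_measurable => // cr.
case: ifPn => // _.
rewrite [X in measurable X](_ : _ = \bigcap_(i in [set: 'I_d])
   ((fun x => g x 0 i) @^-1`
      [set s | `|s - ratr (cr.1 0 i)| < ratr cr.2])); last first.
  by apply/seteqP; split => x /= xr i; [move=> _; exact: xr|exact: xr].
apply: fin_bigcap_measurable => // i _.
rewrite -[X in measurable X]setTI; apply: mg => //.
rewrite (_ : [set _ | _] = ball (ratr (cr.1 0 i) : R) (ratr cr.2)).
  exact: measurable_ball.
by apply/seteqP; split => s; rewrite /ball/= distrC.
Qed.

Lemma measurable_sqn : measurable_fun [set: B] (@sqn R d : B -> R).
Proof.
apply: measurable_sum => i.
by apply: measurable_funX; exact: measurable_coord.
Qed.

Lemma measurable_setcoord (k : nat) :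
  measurable_fun [set: (B * R)%type]
    ((fun zs => setcoord zs.1 k zs.2) : (B * R)%type -> B).
Proof.
apply: measurable_fun_Rd => i; rewrite /setcoord.
under eq_fun do rewrite mxE.
case: ((i : nat) == k); first exact: measurable_snd.
exact: measurableT_comp (measurable_coord i) measurable_fst.
Qed.

End borel.

(** * Iterated Lebesgue integrals *)

(* The integral of [f >= 0] is the supremum over the simple functions below [f],
   so a monotone superadditive functional dominating the measure suffices. *)
Section functional.
Local Open Scope ereal_scope.
Context {R : realType} dT {T : measurableType dT}.
Variables (m : {measure set T -> \bar R}) (I : (T -> \bar R) -> \bar R).
Hypothesis I_indic : forall A, measurable A ->
  m A <= I (fun x => (\1_A x)%:E).
Hypothesis I_ge0 : forall f, (forall x, 0 <= f x) -> 0 <= I f.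
Hypothesis I_Z : forall (k : R) f, (0 <= k)%R -> (forall x, 0 <= f x) ->
  measurable_fun [set: T] f -> k%:E * I f <= I (fun x => k%:E * f x).
Hypothesis I_D : forall f g, (forall x, 0 <= f x) -> (forall x, 0 <= g x) ->
  measurable_fun [set: T] f -> measurable_fun [set: T] g ->
  I f + I g <= I (fun x => f x + g x).
Hypothesis I_le : forall f g, (forall x, 0 <= f x) ->
  measurable_fun [set: T] f -> measurable_fun [set: T] g ->
  (forall x, f x <= g x) -> I f <= I g.

Import HBNNSimple.

Lemma integral_le_functional (f : T -> \bar R) : (forall x, 0 <= f x) ->
  measurable_fun [set: T] f -> \int[m]_x f x <= I f.
Proof.
move=> f0 mf; rewrite ge0_integralTE//.
apply: ge_ereal_sup => _ [h /= hf <-].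
rewrite sintegralE fsbig_finite//=.
(* The values of [h] are kept as a list, so that superadditivity is applied to one value at a
   time. *)
pose F (s : seq R) x := \sum_(r <- s) (r%:E * (\1_(h @^-1` [set r]) x)%:E).
have mA r : measurable (h @^-1` [set r]) by [].
have mi r : measurable_fun setT (fun x => (\1_(h @^-1` [set r]) x)%:E : \bar R).
  exact/measurable_EFinP/measurable_indic.
have mF s : measurable_fun setT (F s).
  by apply: emeasurable_sum => r; exact: measurable_funeM.
have F0 s : all (>= 0)%R s -> forall x, 0 <= F s x.
  move=> /allP s0 x; rewrite /F big_seq; apply: sume_ge0 => r rs.
  by rewrite mule_ge0// lee_fin ?s0.
have key s : all (>= 0)%R s ->
    \sum_(r <- s) r%:E * m (h @^-1` [set r]) <= I (F s).
  elim: s => [_|r s IH /andP[r0 s0]]; first by rewrite big_nil; exact/I_ge0/F0.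
  rewrite big_cons.
  have -> : F (r :: s) = fun x => r%:E * (\1_(h @^-1` [set r]) x)%:E + F s x.
    by apply/funext => x; rewrite /F big_cons.
  apply: le_trans (I_D _ _ _ _); rewrite ?leeD ?IH//.
  - apply: le_trans (I_Z r0 _ (mi r)); last by move=> x; rewrite lee_fin.
    by rewrite lee_wpmul2l// I_indic.
  - by move=> x; rewrite mule_ge0// lee_fin.
  - exact: F0.
  - exact: measurable_funeM.
have s0 : all (>= 0)%R (finmap.enum_fset (fset_set (range h))).
  apply/allP => r rh.
  have : r \in range h.
    exact: etrans (esym (in_fset_set (@fimfunP _ _ h) r)) rh.
  by rewrite inE => -[x _ <-]; exact: fun_ge0.
apply: le_trans (key _ s0) _; apply: I_le => //; first exact: F0.
move=> x; apply: le_trans (hf x).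
rewrite [in leRHS]fimfunE fsbig_finite//= /F -sumEFin.
by under eq_bigr do rewrite -EFinM.
Qed.

End functional.

Section iter_leb.
Local Open Scope ereal_scope.
Context {R : realType} {d : nat}.
Local Notation V := 'rV[R]_d.
Local Notation B := (Rd R d).

Lemma iter_leb_ge0 k (f : V -> \bar R) z :
  (forall y, 0 <= f y) -> 0 <= iter_leb k f z.
Proof.
by move=> f0; elim: k z => //= k IH z; apply: integral_ge0 => s _; exact: IH.
Qed.

(** The parameter and the base point are treated jointly: each further integral is then a section
    integral of a jointly measurable function, whose measurability comes with Tonelli's theorem. *)
Lemma measurable_iter_leb dX (X : measurableType dX) k
    (F : (X * B)%type -> \bar R) :
  (forall xy, 0 <= F xy) -> measurable_fun [set: X * B] F ->
  measurable_fun [set: X * B]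
    (fun xz => iter_leb k (fun y : V => F (xz.1, y)) xz.2).
Proof.
move=> F0 mF; elim: k => [|k IH] /=.
  by rewrite [X in measurable_fun _ X](_ : _ = F)//; apply/funext => -[].
pose H (w : ((X * B) * R)%type) :=
  iter_leb k (fun y : V => F (w.1.1, y)) (setcoord w.1.2 k w.2).
apply: (@measurable_fun_fubini_tonelli_F _ _ _ _ R
  (@lebesgue_measure R) H); last by move=> w; exact: iter_leb_ge0.
suff mG : measurable_fun [set: ((X * B) * R)%type]
    (fun w => (w.1.1, setcoord w.1.2 k w.2 : B)).
  exact: (measurableT_comp IH mG).
apply: measurable_fun_pair; first exact: measurableT_comp.
have mw : measurable_fun [set: ((X * B) * R)%type] (fun w => (w.1.2, w.2)).
  by apply: measurable_fun_pair => //; exact: measurableT_comp.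
exact: (measurableT_comp (measurable_setcoord k) mw).
Qed.

Lemma measurable_iter_leb1 k (f : B -> \bar R) :
  (forall y, 0 <= f y) -> measurable_fun [set: B] f ->
  measurable_fun [set: B] (iter_leb k f : B -> \bar R).
Proof.
move=> f0 mf.
have := @measurable_iter_leb _ B k (fun xy => f xy.2) (fun=> f0 _)
  (measurableT_comp mf measurable_snd).
exact: (@measurable_fun_pair2 _ _ _ B B _ _ (0%R : V)).
Qed.

Lemma measurable_iter_leb_setcoord k j (f : B -> \bar R) z :
  (forall y, 0 <= f y) -> measurable_fun [set: B] f ->
  measurable_fun [set: R] (fun s => iter_leb k f (setcoord z j s)).
Proof.
move=> f0 mf.
have ms := measurable_fun_pair2 (z : B) (measurable_setcoord j).
exact: (measurableT_comp (measurable_iter_leb1 k f0 mf) ms).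
Qed.

Lemma iter_lebD k (f g : B -> \bar R) z :
  (forall y, 0 <= f y) -> measurable_fun [set: B] f ->
  (forall y, 0 <= g y) -> measurable_fun [set: B] g ->
  iter_leb k (fun y => f y + g y) z = iter_leb k f z + iter_leb k g z.
Proof.
move=> f0 mf g0 mg; elim: k z => //= k IH z.
under eq_integral do rewrite IH.
by rewrite ge0_integralD//;
  do ?[by move=> *; exact: iter_leb_ge0|exact: measurable_iter_leb_setcoord].
Qed.

Lemma iter_lebZ k (c : R) (f : B -> \bar R) z : (0 <= c)%R ->
  (forall y, 0 <= f y) -> measurable_fun [set: B] f ->
  iter_leb k (fun y => c%:E * f y) z = c%:E * iter_leb k f z.
Proof.
move=> c0 f0 mf; elim: k z => //= k IH z.
under eq_integral do rewrite IH.
by rewrite ge0_integralZl//;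
  do ?[by move=> *; exact: iter_leb_ge0|exact: measurable_iter_leb_setcoord].
Qed.

Lemma le_iter_leb k (f g : B -> \bar R) z :
  (forall y, 0 <= f y) -> measurable_fun [set: B] f ->
  measurable_fun [set: B] g -> (forall y, f y <= g y) ->
  iter_leb k f z <= iter_leb k g z.
Proof.
move=> f0 mf mg fg; elim: k z => //= k IH z.
have g0 y : 0 <= g y by exact: le_trans (fg y).
by apply: ge0_le_integral => //;
  do ?[by move=> *; exact: iter_leb_ge0|exact: measurable_iter_leb_setcoord].
Qed.

(** Induction on the number of integrated coordinates: those below [k] have become constants, the
    others are still read off the base point [z]. *)
Lemma iter_leb_prod (phi : 'I_d -> R -> R) (c : 'I_d -> R) :
  (forall i s, (0 <= phi i s)%R) ->
  (forall i, measurable_fun [set: R] (phi i)) ->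
  (forall i, \int[@lebesgue_measure R]_s (phi i s)%:E = (c i)%:E) ->
  forall k z, (k <= d)%N ->
  iter_leb k (fun y : V => (\prod_i phi i (y 0%R i))%:E) z =
  (\prod_(i < d) (if (i < k)%N then c i else phi i (z 0%R i)))%:E.
Proof.
move=> phi0 mphi phic.
have c0 i : (0 <= c i)%R.
  by rewrite -lee_fin -phic integral_ge0// => s _; rewrite lee_fin.
elim=> [//|k IH] z kd /=.
pose i0 := Ordinal kd.
pose C := (\prod_(i < d | i != i0)
  (if (i < k)%N then c i else phi i (z 0 i)))%R.
have C0 : (0 <= C)%R by apply: prodr_ge0 => i _; case: ifP.
transitivity (\int[@lebesgue_measure R]_s (C%:E * (phi i0 s)%:E)).
  apply: eq_integral => s _; rewrite IH ?(ltnW kd)// -EFinM; congr EFin.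
  rewrite (bigD1 i0)//= ltnn mulrC {1}/setcoord mxE eqxx; congr (_ * _)%R.
  apply: eq_bigr => i ii0; case: ifPn => // _.
  by rewrite /setcoord mxE ifN.
have mp : measurable_fun [set: R] (fun s => (phi i0 s)%:E).
  by apply/measurable_EFinP; exact: mphi.
rewrite ge0_integralZl//; last by move=> s _; rewrite lee_fin.
rewrite phic -EFinM; congr EFin.
rewrite [RHS](bigD1 i0)//= ltnSn mulrC; congr (_ * _)%R.
apply: eq_bigr => i ii0.
by rewrite ltnS [(i <= k)%N]leq_eqVlt; case: eqVneq => // e; move: ii0; rewrite -val_eqE /= e eqxx.
Qed.

Lemma leb_int_prod (phi : 'I_d -> R -> R) (c : 'I_d -> R) :
  (forall i s, (0 <= phi i s)%R) ->
  (forall i, measurable_fun [set: R] (phi i)) ->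
  (forall i, \int[@lebesgue_measure R]_s (phi i s)%:E = (c i)%:E) ->
  leb_int (fun y : V => (\prod_i phi i (y 0%R i))%:E) = (\prod_(i < d) c i)%:E.
Proof.
move=> phi0 mphi phic; rewrite /leb_int (iter_leb_prod phi0 mphi phic)//.
by congr EFin; apply: eq_bigr => i _; rewrite ltn_ord.
Qed.

Lemma leb_int_ge0 (f : V -> \bar R) : (forall y, 0 <= f y) -> 0 <= leb_int f.
Proof. exact: iter_leb_ge0. Qed.

Lemma measurable_leb_int dX (X : measurableType dX) (F : (X * B)%type -> \bar R) :
  (forall xy, 0 <= F xy) -> measurable_fun [set: X * B] F ->
  measurable_fun [set: X] (fun x => leb_int (fun y : V => F (x, y))).
Proof.
by move=> F0 mF; exact: measurable_fun_pair1 (measurable_iter_leb d F0 mF).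
Qed.

End iter_leb.

(** * Euclidean norm and operator norm *)

Section euclidean.
Context {R : realType} {d : nat}.
Local Notation V := 'rV[R]_d.
Implicit Types (u v w : V) (A : 'M[R]_d).

Definition dot u v : R := \sum_i u 0 i * v 0 i.

Lemma dotvv v : dot v v = sqn v.
Proof. by apply: eq_bigr => i _; rewrite expr2. Qed.

Lemma dotC u v : dot u v = dot v u.
Proof. by apply: eq_bigr => i _; rewrite mulrC. Qed.

Lemma dotDl u v w : dot (u + v) w = dot u w + dot v w.
Proof. by rewrite /dot -big_split; apply: eq_bigr => i _; rewrite mxE mulrDl. Qed.

Lemma dotZl a u v : dot (a *: u) v = a * dot u v.
Proof. by rewrite /dot mulr_sumr; apply: eq_bigr => i _; rewrite mxE mulrA. Qed.

Lemma dotDr u v w : dot u (v + w) = dot u v + dot u w.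
Proof. by rewrite !(dotC u) dotDl. Qed.

Lemma dotZr a u v : dot u (a *: v) = a * dot u v.
Proof. by rewrite !(dotC u) dotZl. Qed.

Lemma dotNl u v : dot (- u) v = - dot u v.
Proof. by rewrite -scaleN1r dotZl mulN1r. Qed.

Lemma dotNr u v : dot u (- v) = - dot u v.
Proof. by rewrite !(dotC u) dotNl. Qed.

Lemma dotBr u v w : dot u (v - w) = dot u v - dot u w.
Proof. by rewrite dotDr dotNr. Qed.

Lemma sqn_ge0 v : 0 <= sqn v.
Proof. by apply: sumr_ge0 => i _; exact: sqr_ge0. Qed.

Lemma sqn0 : sqn (0 : V) = 0.
Proof. by rewrite /sqn big1// => i _; rewrite mxE expr0n. Qed.

Lemma sqnZ a v : sqn (a *: v) = a ^+ 2 * sqn v.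
Proof. by rewrite -!dotvv dotZl dotZr mulrA expr2. Qed.

Lemma sqnN v : sqn (- v) = sqn v.
Proof. by rewrite -!dotvv dotNl dotNr opprK. Qed.

Lemma sqnBC u v : sqn (u - v) = sqn (v - u).
Proof. by rewrite -sqnN opprB. Qed.

Lemma sqnD u v : sqn (u + v) = sqn u + 2 * dot u v + sqn v.
Proof. by rewrite -!dotvv dotDl !dotDr (dotC v u); ring. Qed.

Lemma sqn_eq0 v : sqn v = 0 -> v = 0.
Proof.
move/eqP; rewrite psumr_eq0; last by move=> i _; exact: sqr_ge0.
move=> /allP v0; apply/rowP => i; rewrite mxE; apply/eqP.
by have := v0 i (mem_index_enum i); rewrite sqrf_eq0.
Qed.

Lemma sqn_coord v i : (v 0 i) ^+ 2 <= sqn v.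
Proof. by rewrite /sqn (bigD1 i)//= lerDl; apply: sumr_ge0 => j _; exact: sqr_ge0. Qed.

(** Cauchy-Schwarz: the squared norm of [sqn v *: u - dot u v *: v] is [sqn v] times the difference
    of the two sides. *)
Lemma dot_sqr_le u v : (dot u v) ^+ 2 <= sqn u * sqn v.
Proof.
have [v0|v0] := eqVneq (sqn v) 0.
  rewrite v0 mulr0 (sqn_eq0 v0) /dot big1 ?expr0n// => i _.
  by rewrite mxE mulr0.
have vp : 0 < sqn v by rewrite lt_def v0 sqn_ge0.
have := sqn_ge0 (sqn v *: u - dot u v *: v).
rewrite sqnD sqnN !sqnZ dotNr dotZl dotZr.
rewrite (_ : _ + _ = sqn v * (sqn u * sqn v - dot u v ^+ 2)); last by ring.
by rewrite pmulr_rge0// subr_ge0.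
Qed.

Lemma sqnD_le u v : sqn (u + v) <= 2 * sqn u + 2 * sqn v.
Proof. by have := sqn_ge0 (u - v); rewrite !sqnD sqnN dotNr; lra. Qed.

(** The library norm on row vectors is the maximum of the coordinates. It gives the same topology,
    but the operator norm and the transport cost are Euclidean. *)
Definition enorm v : R := Num.sqrt (sqn v).

Lemma enorm_ge0 v : 0 <= enorm v. Proof. exact: sqrtr_ge0. Qed.

Lemma enorm_sqr v : enorm v ^+ 2 = sqn v.
Proof. by rewrite sqr_sqrtr// sqn_ge0. Qed.

Lemma dot_le_enorm u v : dot u v <= enorm u * enorm v.
Proof.
apply: le_trans (ler_norm _) _.
rewrite -sqrtr_sqr -sqrtrM ?sqn_ge0// ler_wsqrtr//; exact: dot_sqr_le.
Qed.

Lemma enormD u v : enorm (u + v) <= enorm u + enorm v.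
Proof.
rewrite -(ler_pXn2r (n := 2))// ?nnegrE ?addr_ge0 ?enorm_ge0//.
rewrite enorm_sqr sqnD sqrrD !enorm_sqr lerD2r lerD2l.
by have := dot_le_enorm u v; lra.
Qed.

Lemma enormZ a v : enorm (a *: v) = `|a| * enorm v.
Proof. by rewrite /enorm sqnZ sqrtrM ?sqr_ge0// sqrtr_sqr. Qed.

(** The squared Frobenius norm. Its root dominates the operator norm, which makes [opnorm] finite
    and continuous in the entries. *)
Definition frob A : R := \sum_i \sum_j (A i j) ^+ 2.

Lemma sqn_mulmx_le u A : sqn (u *m A) <= sqn u * frob A.
Proof.
have -> : frob A = \sum_j sqn (\row_i A i j).
  rewrite /frob exchange_big; apply: eq_bigr => j _.
  by apply: eq_bigr => i _; rewrite mxE.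
rewrite mulr_sumr; apply: ler_sum => j _.
rewrite (_ : (u *m A) 0 j = dot u (\row_i A i j)) ?dot_sqr_le// mxE.
by apply: eq_bigr => i _; rewrite mxE.
Qed.

Let opset A := [set Num.sqrt (sqn (u *m A)) | u in [set u : V | sqn u = 1]].

Let opset_ub A : ubound (opset A) (Num.sqrt (frob A)).
Proof.
move=> _ [u /= u1 <-]; rewrite ler_wsqrtr//.
by rewrite (le_trans (sqn_mulmx_le _ _))// u1 mul1r.
Qed.

(** For d = 0 there is no unit vector, and [sup] of the empty set is 0 by convention, so this case
    is carried along. *)
Let opset_cases A : opset A = set0 \/ has_sup (opset A).
Proof.
have [->|/set0P ne] := eqVneq (opset A) set0; first by left.
by right; split => //; exists (Num.sqrt (frob A)); exact: opset_ub.
Qed.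

Lemma opnorm_ge0 A : 0 <= opnorm A.
Proof.
rewrite /opnorm -/(opset A); have [->|[[s As] hs]] := opset_cases A.
  by rewrite sup0.
apply: le_trans (ub_le_sup hs As); case: As => u _ <-; exact: sqrtr_ge0.
Qed.

Lemma opnorm_le_frob A : opnorm A <= Num.sqrt (frob A).
Proof.
rewrite /opnorm -/(opset A); have [->|[ne hs]] := opset_cases A.
  by rewrite sup0 sqrtr_ge0.
by apply: ge_sup => //; exact: opset_ub.
Qed.

Lemma enorm_mulmx_le u A : enorm (u *m A) <= opnorm A * enorm u.
Proof.
have [u0|u0] := eqVneq (sqn u) 0.
  by rewrite (sqn_eq0 u0) mul0mx /enorm sqn0 sqrtr0 mulr0.
have eu0 : 0 < enorm u by rewrite sqrtr_gt0 lt_def u0 sqn_ge0.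
pose w := (enorm u)^-1 *: u.
have eu : u = enorm u *: w by rewrite /w scalerA divff ?scale1r// gt_eqF.
have w1 : sqn w = 1.
  by rewrite /w sqnZ -enorm_sqr exprVn mulVf// expf_neq0// gt_eqF.
rewrite [in leLHS]eu -scalemxAl enormZ (ger0_norm (ltW eu0)).
rewrite mulrC ler_wpM2r ?enorm_ge0//.
apply: ub_le_sup; first by exists (Num.sqrt (frob A)); exact: opset_ub.
by exists w.
Qed.

Lemma dot_mulmx_le u v A : dot (u *m A) v <= opnorm A * enorm u * enorm v.
Proof.
apply: le_trans (dot_le_enorm _ _) _.
by rewrite ler_wpM2r ?enorm_ge0// enorm_mulmx_le.
Qed.

Lemma opnorm_le_add A A' : opnorm A <= opnorm A' + Num.sqrt (frob (A - A')).
Proof.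
rewrite {1}/opnorm -/(opset A); have [->|[ne hs]] := opset_cases A.
  by rewrite sup0 addr_ge0 ?opnorm_ge0 ?sqrtr_ge0.
apply: ge_sup => // _ [u /= u1 <-].
have -> : u *m A = u *m A' + u *m (A - A') by rewrite -mulmxDr addrC subrK.
apply: le_trans (enormD _ _) _; rewrite lerD//.
  by apply: le_trans (enorm_mulmx_le _ _) _; rewrite /enorm u1 sqrtr1 mulr1.
rewrite ler_wsqrtr// (le_trans (sqn_mulmx_le _ _))// u1 mul1r //.
Qed.

Lemma opnorm_dist_le A A' : `|opnorm A - opnorm A'| <= Num.sqrt (frob (A - A')).
Proof.
rewrite ler_norml; apply/andP; split; last first.
  by rewrite lerBlDl; exact: opnorm_le_add.
rewrite lerNl opprB lerBlDl.
rewrite (_ : frob (A - A') = frob (A' - A)); first exact: opnorm_le_add.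
by apply: eq_bigr => i _; apply: eq_bigr => j _; rewrite !mxE -sqrrN opprB.
Qed.

Lemma continuous_sqnP (f : V -> R) :
  (forall y e, 0 < e -> exists2 del, 0 < del &
     forall y', sqn (y' - y) < del -> `|f y' - f y| < e) -> continuous f.
Proof.
move=> fP y U /= /(nbhs_ballP (f y))[e /= e0 eU].
have [del del0 fdel] := fP y e e0.
(* A sum of d squares of size at most del / (d + 1) stays strictly below del, also for d = 0. *)
have c0 : 0 < del / d.+1%:R by rewrite divr_gt0.
apply/nbhs_ballP; exists (Num.sqrt (del / d.+1%:R)) => /=.
  by rewrite sqrtr_gt0.
move=> y' [_ yy']; apply: eU; rewrite /ball/= distrC; apply: fdel.
apply: (@le_lt_trans _ _ (\sum_(i < d) (del / d.+1%:R))).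
  apply: ler_sum => i _; rewrite !mxE.
  rewrite -[leRHS](sqr_sqrtr (ltW c0)) -[leLHS]real_normK ?num_real//.
  rewrite ler_pXn2r ?nnegrE ?sqrtr_ge0// distrC.
  by have := yy' 0 i => /ltW.
rewrite sumr_const card_ord -(mulr_natr _ d) -mulrA gtr_pMr// mulrC.
by rewrite ltr_pdivrMr// mul1r ltr_nat.
Qed.

End euclidean.

(** * The Gaussian channel: evidence and posterior *)

Section posterior.
Context {R : realType} {d : nat}.
Local Notation V := 'rV[R]_d.
Local Notation B := (Rd R d).
Variables (mu : probability B R) (r : R).
Hypothesis mu2 : (\int[mu]_x (sqn x)%:E < +oo)%E.
Implicit Types (g : V -> R) (y h : V).

(** Growth at most quadratic: a second moment of [mu] makes all these functions integrable, and the
    weight [postw], being at most 1, preserves the class. *)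
Definition quad g := measurable_fun [set: B] (g : B -> R) /\
  exists2 C, 0 <= C & forall x, `|g x| <= C * (1 + sqn x).

Lemma quad_le g g' C : quad g' -> measurable_fun [set: B] (g : B -> R) ->
  0 <= C -> (forall x, `|g x| <= C * `|g' x|) -> quad g.
Proof.
move=> [_ [C' C'0 gC']] mg C0 gC; split => //.
exists (C * C'); first exact: mulr_ge0.
by move=> x; rewrite (le_trans (gC x))// -mulrA ler_wpM2l.
Qed.

Lemma quad_cst c : quad (fun=> c).
Proof.
split; first exact: measurable_cst.
by exists `|c| => // x; rewrite ler_peMr// lerDl sqn_ge0.
Qed.

Lemma quadD g g' : quad g -> quad g' -> quad (fun x => g x + g' x).
Proof.
move=> [mg [C C0 gC]] [mg' [C' C'0 gC']]; split; first exact: measurable_funD.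
exists (C + C'); first exact: addr_ge0.
by move=> x; rewrite (le_trans (ler_normD _ _))// mulrDl lerD.
Qed.

Lemma quadZ c g : quad g -> quad (fun x => c * g x).
Proof.
move=> qg; apply: (quad_le (C := `|c|) qg) => //.
  by apply: measurable_funM => //; exact: qg.1.
by move=> x; rewrite normrM.
Qed.

Lemma quadN g : quad g -> quad (fun x => - g x).
Proof. by move=> /(quadZ (-1)); under eq_fun do rewrite mulN1r. Qed.

Lemma quadB g g' : quad g -> quad g' -> quad (fun x => g x - g' x).
Proof. by move=> qg /quadN qg'; exact: quadD. Qed.

Lemma quad_sum I (s : seq I) (g : I -> V -> R) :
  (forall i, quad (g i)) -> quad (fun x => \sum_(i <- s) g i x).
Proof.
move=> qg; elim: s => [|i s IH].
  by under eq_fun do rewrite big_nil; exact: quad_cst.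
by under eq_fun do rewrite big_cons; exact: quadD.
Qed.

Lemma quad_sqn : quad (@sqn R d).
Proof.
split; first exact: measurable_sqn.
by exists 1 => // x; rewrite mul1r ger0_norm ?sqn_ge0// lerDr.
Qed.

Lemma measurable_dot h : measurable_fun [set: B] (dot h : B -> R).
Proof.
by apply: measurable_sum => i; apply: measurable_funM => //; exact: measurable_coord.
Qed.

(** Growth at most linear, so that a product of two such functions, as in a covariance or in the
    derivative of a weighted integral, is still [quad]. *)
Definition sublin g := measurable_fun [set: B] (g : B -> R) /\
  exists2 C, 0 <= C & forall x, `|g x| <= C * (1 + enorm x).

Lemma sublinM g g' : sublin g -> sublin g' -> quad (fun x => g x * g' x).
Proof.
move=> [mg [C C0 gC]] [mg' [C' C'0 gC']]; split; first exact: measurable_funM.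
exists (2 * (C * C')); first by rewrite !mulr_ge0.
move=> x; rewrite normrM (le_trans (ler_pM _ _ (gC x) (gC' x)))//.
have := sqr_ge0 (1 - enorm x); rewrite -enorm_sqr => h1.
rewrite -subr_ge0 (_ : _ - _ = C * C' * (1 - enorm x) ^+ 2); last by ring.
by rewrite mulr_ge0// mulr_ge0.
Qed.

Lemma sublin_cst c : sublin (fun=> c).
Proof.
split; first exact: measurable_cst.
by exists `|c| => // x; rewrite ler_peMr// lerDl enorm_ge0.
Qed.

Lemma sublinD g g' : sublin g -> sublin g' -> sublin (fun x => g x + g' x).
Proof.
move=> [mg [C C0 gC]] [mg' [C' C'0 gC']]; split; first exact: measurable_funD.
exists (C + C'); first exact: addr_ge0.
by move=> x; rewrite (le_trans (ler_normD _ _))// mulrDl lerD.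
Qed.

Lemma sublinZ c g : sublin g -> sublin (fun x => c * g x).
Proof.
move=> [mg [C C0 gC]]; split; first exact: measurable_funM.
exists (`|c| * C); first exact: mulr_ge0.
by move=> x; rewrite normrM -mulrA ler_wpM2l.
Qed.

Lemma norm_dot_le (u v : V) : `|dot u v| <= enorm u * enorm v.
Proof.
rewrite ler_norml dot_le_enorm andbT lerNl -dotNl.
by rewrite (le_trans (dot_le_enorm _ _))// /enorm sqnN.
Qed.

Lemma sublin_dot h : sublin (dot h).
Proof.
split; first exact: measurable_dot.
exists (enorm h); first exact: enorm_ge0.
by move=> x; rewrite (le_trans (norm_dot_le _ _))// ler_wpM2l ?enorm_ge0// lerDr.
Qed.

Lemma sublin_coord i : sublin (fun x => x 0 i).
Proof.
split; first exact: measurable_coord.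
exists 1 => // x; rewrite mul1r.
rewrite (@le_trans _ _ (enorm x)) ?lerDr// -sqrtr_sqr ler_wsqrtr//.
exact: sqn_coord.
Qed.

Lemma sublin_quad g : sublin g -> quad g.
Proof.
by move=> sg; have := sublinM (sublin_cst 1) sg; under eq_fun do rewrite mul1r.
Qed.

Lemma integrable_quad g : quad g -> mu.-integrable [set: B] (EFin \o g).
Proof.
move=> [mg [C C0 gC]].
apply: (@le_integrable _ _ _ mu setT _ _ (fun x : B => (C * (1 + sqn x))%:E)) => //.
- by apply/measurable_EFinP.
- move=> x _ /=; rewrite lee_fin (le_trans (gC x))//.
  by rewrite ler_norm.
under eq_fun do rewrite EFinM EFinD.
apply: integrableZl => //; apply: integrableD => //.
  exact: finite_measure_integrable_cst.
apply/integrableP; split; first by apply/measurable_EFinP; exact: measurable_sqn.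
by under eq_integral do rewrite gee0_abs ?lee_fin ?sqn_ge0//.
Qed.

Lemma postw_gt0 y (x : V) : 0 < postw r y x. Proof. exact: expR_gt0. Qed.

Lemma postw_le1 y (x : V) : postw r y x <= 1.
Proof.
by rewrite -expR0 ler_expR mulNr oppr_le0 divr_ge0// sqn_ge0.
Qed.

Lemma quad_sqnB y : quad (fun x => sqn (y - r *: x)).
Proof.
rewrite (_ : (fun _ => _) =
    fun x => (sqn y + (- (2 * r)) * dot y x) + r ^+ 2 * sqn x); last first.
  by apply/funext => x; rewrite sqnD sqnN sqnZ dotNr dotZr; ring.
apply: quadD; last by apply: quadZ; exact: quad_sqn.
apply: quadD; first exact: quad_cst.
by apply: quadZ; apply: sublin_quad; exact: sublin_dot.
Qed.

Lemma measurable_postw y : measurable_fun [set: B] (postw r y : B -> R).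
Proof.
apply: measurableT_comp => //; apply: measurable_funM => //.
apply: measurableT_comp => //; exact: (quad_sqnB y).1.
Qed.

Lemma quad_postw g y : quad g -> quad (fun x => g x * postw r y x).
Proof.
move=> qg; apply: (quad_le (C := 1) qg) => //.
  by apply: measurable_funM; [exact: qg.1|exact: measurable_postw].
move=> x; rewrite mul1r normrM (ger0_norm (ltW (postw_gt0 _ _))).
by rewrite ler_piMr// postw_le1.
Qed.

(** The numerator of [postE]: continuity and derivatives are established for it and pass to the
    quotient afterwards. *)
Definition pint g y := \int[mu]_x (g x * postw r y x).

Definition evid y := \int[mu]_x postw r y x.

Lemma pint1 y : pint (fun=> 1) y = evid y.
Proof. by apply: eq_Rintegral => x _; rewrite mul1r. Qed.

Lemma pintD g g' y : quad g -> quad g' ->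
  pint (fun x => g x + g' x) y = pint g y + pint g' y.
Proof.
move=> qg qg'; rewrite /pint -RintegralD//;
  [|by apply: integrable_quad; exact: quad_postw..].
by apply: eq_Rintegral => x _; rewrite mulrDl.
Qed.

Lemma pintZ c g y : quad g -> pint (fun x => c * g x) y = c * pint g y.
Proof.
move=> qg; rewrite /pint -RintegralZl//; last first.
  by apply: integrable_quad; exact: quad_postw.
by apply: eq_Rintegral => x _; rewrite mulrA.
Qed.

Lemma le_pint g g' y : quad g -> quad g' -> (forall x, g x <= g' x) ->
  pint g y <= pint g' y.
Proof.
move=> qg qg' gg'; apply: le_Rintegral => //;
  do ?[by apply: integrable_quad; exact: quad_postw].
by move=> x _; rewrite ler_wpM2r// ltW// postw_gt0.
Qed.

Lemma Rint_cst c : \int[mu]_(x in [set: B]) c = c.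
Proof.
rewrite Rintegral_cst// [X in fine X](_ : _ = 1%E) ?mulr1//.
exact: probability_setT.
Qed.

Lemma quad1_postw y : quad (postw r y).
Proof.
by have := quad_postw y (quad_cst 1); under eq_fun do rewrite mul1r.
Qed.

(* Jensen's inequality, through the tangent line of exp at the mean. *)
Lemma evid_gt0 y : 0 < evid y.
Proof.
have qs : quad (fun x => sqn (y - r *: x) / 2).
  by under eq_fun do rewrite mulrC; apply: quadZ; exact: quad_sqnB.
set k := \int[mu]_x (sqn (y - r *: x) / 2).
apply: (@lt_le_trans _ _ (expR (- k))); first exact: expR_gt0.
have -> : expR (- k) = \int[mu]_x (expR (- k) * (1 + k - sqn (y - r *: x) / 2)).
  rewrite RintegralZl//; last first.
    by apply: integrable_quad; apply: quadB => //; exact: quad_cst.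
  rewrite RintegralB//; do ?[by apply: integrable_quad => //; exact: quad_cst].
  by rewrite Rint_cst -/k addrK mulr1.
apply: le_Rintegral => //.
- apply: integrable_quad; apply: quadZ; apply: quadB => //; exact: quad_cst.
- by apply: integrable_quad; exact: quad1_postw.
move=> x _; rewrite /postw mulNr.
set s := sqn _ / 2.
have -> : expR (- s) = expR (- k) * expR (k - s).
  by rewrite -expRD; congr expR; ring.
by rewrite ler_wpM2l ?expR_ge0// -addrA expR_ge1Dx.
Qed.

Lemma evid_le1 y : evid y <= 1.
Proof.
rewrite -[leRHS]Rint_cst; apply: le_Rintegral => //.
- by apply: integrable_quad; exact: quad1_postw.
- by apply: integrable_quad; exact: quad_cst.
- by move=> x _; exact: postw_le1.
Qed.

(** Negative log-evidence. It measures how untypical y is: it bounds the posterior covariance, and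
    the density of mu_t decays like its exponential. *)
Definition loss y := - ln (evid y).

Lemma loss_ge0 y : 0 <= loss y.
Proof. by rewrite /loss oppr_ge0 ln_le0// evid_le1. Qed.

(* [s e^{-s} <= (k - 1) e^{-s} + e^{-k}], integrated with [k = loss y]. *)
Lemma pint_sqn_le y : pint (fun x => sqn (y - r *: x)) y <= 2 * loss y * evid y.
Proof.
have qs : quad (fun x => sqn (y - r *: x) / 2).
  by under eq_fun do rewrite mulrC; apply: quadZ; exact: quad_sqnB.
set k := loss y.
have ek : expR (- k) = evid y by rewrite /k opprK lnK// posrE evid_gt0.
suff : pint (fun x => sqn (y - r *: x) / 2) y <= k * evid y.
  under [X in pint X]eq_fun do rewrite mulrC.
  by rewrite pintZ; [lra|exact: quad_sqnB].
have -> : k * evid y =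
    \int[mu]_x ((k - 1) * postw r y x + expR (- k)).
  rewrite RintegralD//; [|by apply: integrable_quad => //;
     do ?[apply: quadZ; exact: quad1_postw|exact: quad_cst]..].
  rewrite RintegralZl//; last by apply: integrable_quad; exact: quad1_postw.
  by rewrite Rint_cst ek -/(evid y); ring.
apply: le_Rintegral => //.
- by apply: integrable_quad; exact: quad_postw.
- apply: integrable_quad; apply: quadD; last exact: quad_cst.
  by apply: quadZ; exact: quad1_postw.
move=> x _; rewrite /postw mulNr; set s := sqn _ / 2.
have -> : expR (- k) = expR (- s) * expR (s - k).
  by rewrite -expRD; congr expR; ring.
rewrite mulrC -subr_ge0.
rewrite (_ : _ - _ = expR (- s) * (expR (s - k) - (1 + (s - k)))); last by ring.
by rewrite mulr_ge0 ?expR_ge0// subr_ge0 expR_ge1Dx.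
Qed.

(* The parallelogram inequality and [e^{-2s} >= 2 q e^{-s} - q^2]. *)
Lemma evid_shift_ge y h : expR (- sqn h) * evid y ^+ 2 <= evid (y + h).
Proof.
set q := evid y.
have -> : expR (- sqn h) * q ^+ 2 =
    \int[mu]_x (expR (- sqn h) * (2 * q * postw r y x + - q ^+ 2)).
  rewrite RintegralZl//; last first.
    apply: integrable_quad; apply: quadD; last exact: quad_cst.
    by apply: quadZ; exact: quad1_postw.
  rewrite RintegralD//; [|by apply: integrable_quad => //;
     do ?[apply: quadZ; exact: quad1_postw|exact: quad_cst]..].
  rewrite RintegralZl//; last by apply: integrable_quad; exact: quad1_postw.
  by rewrite Rint_cst -/(evid y) -/q; ring.
apply: le_Rintegral => //.
- apply: integrable_quad; apply: quadZ; apply: quadD; last exact: quad_cst.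
  by apply: quadZ; exact: quad1_postw.
- by apply: integrable_quad; exact: quad1_postw.
move=> x _; apply: (@le_trans _ _ (expR (- sqn h) * postw r y x ^+ 2)).
  rewrite ler_wpM2l ?expR_ge0// -subr_ge0.
  rewrite (_ : _ - _ = (postw r y x - q) ^+ 2) ?sqr_ge0//; ring.
rewrite /postw -expRM_natl -expRD ler_expR.
by have := sqnD_le (y - r *: x) h; rewrite addrAC; lra.
Qed.

Lemma loss_shift_le y h : loss (y + h) <= sqn h + 2 * loss y.
Proof.
have := evid_shift_ge y h; have := evid_gt0 y; have := evid_gt0 (y + h).
rewrite /loss; move: (evid y) (evid (y + h)) (sqn h) => q q' s q'0 q0 qq'.
have q20 : 0 < q ^+ 2 by rewrite exprn_gt0.
have : ln (expR (- s) * q ^+ 2) <= ln q'.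
  by rewrite ler_ln ?posrE// mulr_gt0 ?expR_gt0.
rewrite lnM ?posrE ?expR_gt0// expRK lnXn// -mulr_natl.
lra.
Qed.

End posterior.

(** * Posterior mean and covariance, and their control by the loss *)

Section posterior_mean.
Context {R : realType} {d : nat}.
Local Notation V := 'rV[R]_d.
Local Notation B := (Rd R d).
Variables (mu : probability B R) (r : R).
Hypothesis mu2 : (\int[mu]_x (sqn x)%:E < +oo)%E.
Implicit Types (g : V -> R) (u y h : V).

Lemma postED g g' y : quad g -> quad g' ->
  postE mu r y (fun x => g x + g' x) = postE mu r y g + postE mu r y g'.
Proof. by move=> qg qg'; rewrite /postE -mulrDl -/(pint mu r _ y) pintD. Qed.

Lemma postEZ c g y : quad g ->
  postE mu r y (fun x => c * g x) = c * postE mu r y g.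
Proof. by move=> qg; rewrite /postE mulrA -/(pint mu r _ y) pintZ. Qed.

Lemma postE_cst c y : postE mu r y (fun=> c) = c.
Proof.
rewrite (_ : (fun=> c) = fun x => c * (fun=> 1) x); last first.
  by apply/funext => x; rewrite mulr1.
rewrite postEZ; last exact: quad_cst.
rewrite /postE -/(pint mu r (fun=> 1) y) pint1 divff ?mulr1// gt_eqF//.
exact: evid_gt0.
Qed.

Lemma postEB g g' y : quad g -> quad g' ->
  postE mu r y (fun x => g x - g' x) = postE mu r y g - postE mu r y g'.
Proof.
move=> qg qg'; rewrite postED//; last exact: quadN.
rewrite -mulN1r -postEZ//; congr (_ + postE _ _ _ _).
by apply/funext => x; rewrite mulN1r.
Qed.

Lemma postE_sum I (s : seq I) (g : I -> V -> R) y : (forall i, quad (g i)) ->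
  postE mu r y (fun x => \sum_(i <- s) g i x) = \sum_(i <- s) postE mu r y (g i).
Proof.
move=> qg; elim: s => [|i s IH].
  by under eq_fun do rewrite big_nil; rewrite postE_cst big_nil.
under eq_fun do rewrite big_cons.
by rewrite big_cons postED ?IH//; exact: quad_sum.
Qed.

Lemma le_postE g g' y : quad g -> quad g' -> (forall x, g x <= g' x) ->
  postE mu r y g <= postE mu r y g'.
Proof.
move=> qg qg' gg'; apply: ler_wpM2r; last exact: le_pint.
by rewrite invr_ge0; exact: ltW (evid_gt0 r mu2 y).
Qed.

Lemma norm_postE_le g y : quad g ->
  `|postE mu r y g| <= postE mu r y (fun x => `|g x|).
Proof.
move=> qg.
have qn : quad (fun x => `|g x|).
  apply: (quad_le (C := 1) qg) => //; last by move=> x; rewrite mul1r normr_id.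
  by apply: measurableT_comp => //; exact: qg.1.
rewrite ler_norml; apply/andP; split; last first.
  by apply: le_postE => // x; exact: ler_norm.
rewrite -mulN1r -postEZ//; apply: le_postE => //; first exact: quadZ.
by move=> x; rewrite mulN1r lerNl -normrN ler_norm.
Qed.

Definition pmean y : V := \row_i postE mu r y (fun x => r * x 0 i).

Let sublin_rcoord i : sublin (fun x : V => r * x 0 i).
Proof. by apply: sublinZ; exact: sublin_coord. Qed.

Let rdotE u (x : V) : r * dot u x = \sum_i u 0 i * (r * x 0 i).
Proof. by rewrite mulr_sumr; apply: eq_bigr => i _; ring. Qed.

Lemma dot_pmean u y : dot u (pmean y) = postE mu r y (fun x => r * dot u x).
Proof.
transitivity (postE mu r y (fun x => \sum_i u 0 i * (r * x 0 i))).
  rewrite postE_sum; last by move=> i; apply: quadZ; exact: sublin_quad.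
  by apply: eq_bigr => i _; rewrite mxE (postEZ (u 0 i))//; exact: sublin_quad.
by congr postE; apply/funext => x; rewrite rdotE.
Qed.

(** As a bilinear form the matrix is the posterior covariance of two linear functionals, which is
    the shape that the quotient rule produces for the derivative of the posterior mean. *)
Lemma condcov_form u h y : dot (u *m condcov mu r y) h =
  postE mu r y (fun x => (r * dot u x) * (r * dot h x))
  - postE mu r y (fun x => r * dot u x) * postE mu r y (fun x => r * dot h x).
Proof.
rewrite -!dot_pmean.
have -> : postE mu r y (fun x => r * dot u x * (r * dot h x)) =
    postE mu r y (fun x => \sum_i \sum_j
      (u 0 i * h 0 j) * ((r * x 0 i) * (r * x 0 j))).
  congr postE; apply/funext => x; rewrite !rdotE mulr_suml.
  by apply: eq_bigr => i _; rewrite mulr_sumr; apply: eq_bigr => j _; ring.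
have q2 i j : quad (fun x : V => r * x 0 i * (r * x 0 j)) by exact: sublinM.
rewrite postE_sum; last by move=> i; apply: quad_sum => j; exact: quadZ.
under [in RHS]eq_bigr => i _.
  rewrite postE_sum; last by move=> j; exact: quadZ.
  under eq_bigr => j _ do rewrite postEZ//.
  over.
rewrite {2 3}/dot mulr_suml -sumrB.
transitivity (\sum_j \sum_i u 0 i * condcov mu r y i j * h 0 j).
  by apply: eq_bigr => j _; rewrite mxE mulr_suml.
rewrite exchange_big; apply: eq_bigr => i _.
rewrite mulr_sumr -sumrB; apply: eq_bigr => j _; rewrite !mxE; ring.
Qed.

Let norm_mul_le (a b e : R) : a ^+ 2 <= e -> b ^+ 2 <= e -> `|a * b| <= e.
Proof.
move=> ae be; have := sqr_ge0 (a - b); have := sqr_ge0 (a + b).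
by rewrite ler_norml => h1 h2; apply/andP; split; lra.
Qed.

Let E2 y := postE mu r y (fun x => sqn (y - r *: x)).

Let E2_le y : E2 y <= 2 * loss mu r y.
Proof.
have e0 := evid_gt0 r mu2 y.
by rewrite /E2 /postE ler_pdivrMr// pint_sqn_le.
Qed.

(** A covariance does not change when the coordinates are centred at y instead of their mean. The
    mean product and the product of means are then each at most the posterior mean of |y - r x|^2,
    which is at most twice the loss; together they give the factor 4. *)
Lemma norm_condcov_le y i j : `|condcov mu r y i j| <= 4 * loss mu r y.
Proof.
pose c i (x : V) := r * x 0 i - y 0 i.
have sc k : sublin (c k) by apply: sublinD => //; exact: sublin_cst.
have qs := quad_sqnB r y.
have cx k (x : V) : c k x ^+ 2 <= sqn (y - r *: x).
  by rewrite sqnBC; have := sqn_coord (r *: x - y) k; rewrite !mxE.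
have -> : condcov mu r y i j = postE mu r y (fun x => c i x * c j x)
    - postE mu r y (c i) * postE mu r y (c j).
  have Ec k : postE mu r y (c k) = postE mu r y (fun x => r * x 0 k) - y 0 k.
    rewrite postEB ?postE_cst//; [exact: sublin_quad|exact: quad_cst].
  have -> : postE mu r y (fun x => c i x * c j x) = postE mu r y (fun x =>
      r * x 0 i * (r * x 0 j)
      - (y 0 i * (r * x 0 j) + (y 0 j * (r * x 0 i) - y 0 i * y 0 j))).
    by congr postE; apply/funext => x; rewrite /c; ring.
  have qr k : quad (fun x : V => r * x 0 k) by exact: sublin_quad.
  rewrite postEB; last 2 first.
    exact: sublinM.
    apply: quadD; first exact: quadZ.
    by apply: quadB; [exact: quadZ|exact: quad_cst].
  rewrite postED; last 2 first.
    exact: quadZ.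
    by apply: quadB; [exact: quadZ|exact: quad_cst].
  rewrite postEB; last 2 first.
    exact: quadZ.
    exact: quad_cst.
  by rewrite postE_cst (postEZ (y 0 i))// (postEZ (y 0 j))// !Ec !mxE; ring.
clearbody c.
(* Jensen's inequality for the square: the posterior mean of (c - E c)^2 is nonnegative. *)
have Esq k : postE mu r y (c k) ^+ 2 <= E2 y.
  have := @le_postE (fun=> 0) (fun x => c k x * c k x
    + (- (2 * postE mu r y (c k)) * c k x + postE mu r y (c k) ^+ 2)) y.
  have q1 : quad (fun x => - (2 * postE mu r y (c k)) * c k x).
    by apply: quadZ; exact: sublin_quad.
  rewrite postE_cst postED; last 2 first.
    exact: sublinM.
    by apply: quadD => //; exact: quad_cst.
  rewrite postED//; last exact: quad_cst.
  rewrite postEZ ?postE_cst; last exact: sublin_quad.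
  move=> /(_ (quad_cst _)) H.
  have {}H : 0 <= postE mu r y (fun x => c k x * c k x) - postE mu r y (c k) ^+ 2.
    rewrite (_ : _ - _ = postE mu r y (fun x => c k x * c k x)
      + (- (2 * postE mu r y (c k)) * postE mu r y (c k)
      + postE mu r y (c k) ^+ 2)); last by ring.
    apply: H => [|x].
      by apply: quadD; [exact: sublinM|apply: quadD => //; exact: quad_cst].
    rewrite (_ : _ + _ = (c k x - postE mu r y (c k)) ^+ 2) ?sqr_ge0//.
    by ring.
  rewrite subr_ge0 in H; apply: le_trans H _; apply: le_postE => //.
  exact: sublinM.
  by move=> x; rewrite -expr2.
have qn : quad (fun x => `|c i x * c j x|).
  apply: (quad_le (C := 1) (sublinM (sc i) (sc j))) => //.
    apply: measurableT_comp => //; exact: (sublinM (sc i) (sc j)).1.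
  by move=> x; rewrite mul1r normr_id.
have Eij : `|postE mu r y (fun x => c i x * c j x)| <= E2 y.
  apply: le_trans (norm_postE_le _ (sublinM (sc i) (sc j))) _.
  by apply: le_postE => // x; exact: norm_mul_le.
have Eiej : `|postE mu r y (c i) * postE mu r y (c j)| <= E2 y.
  exact: norm_mul_le.
rewrite (le_trans (ler_normB _ _))//.
by have := E2_le y; lra.
Qed.

(** The factor d is the root of the number d^2 of entries in the Frobenius norm. *)
Lemma Lr_le_loss y : Lr mu r y <= 4 * d%:R * loss mu r y.
Proof.
have l0 := loss_ge0 r mu2 y.
apply: le_trans (opnorm_le_frob _) _.
rewrite -[leRHS]ger0_norm ?mulr_ge0// -sqrtr_sqr ler_wsqrtr//.
apply: (@le_trans _ _ (\sum_(i < d) \sum_(j < d) (4 * loss mu r y) ^+ 2)).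
  apply: ler_sum => i _; apply: ler_sum => j _.
  rewrite -[leLHS]real_normK ?num_real// ler_pXn2r ?nnegrE ?mulr_ge0//.
  exact: norm_condcov_le.
rewrite !sumr_const card_ord.
have -> : (4 * loss mu r y) ^+ 2 *+ d *+ d = (4 * loss mu r y) ^+ 2 * (d%:R * d%:R).
  by rewrite -natrM mulr_natr mulrnA.
by rewrite le_eqVlt; apply/orP; left; apply/eqP; ring.
Qed.

End posterior_mean.

(** * Differentiation and continuity of the posterior mean *)

Section posterior_derivative.
Context {R : realType} {d : nat}.
Local Notation V := 'rV[R]_d.
Local Notation B := (Rd R d).
Variables (mu : probability B R) (r : R).
Hypothesis mu2 : (\int[mu]_x (sqn x)%:E < +oo)%E.
Implicit Types (g : V -> R) (u y h : V).

Lemma is_derive_postw y h (x : V) (s : R) :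
  is_derive s 1 (fun s => postw r (y + s *: h) x)
    ((r * dot h x - dot h (y + s *: h)) * postw r (y + s *: h) x).
Proof.
pose z := y - r *: x.
have sE (t : R) : postw r (y + t *: h) x =
    expR (- (sqn z + 2 * t * dot h z + t ^+ 2 * sqn h) / 2).
  rewrite /postw; congr (expR (- _ / 2)).
  by rewrite addrAC -/z sqnD sqnZ dotZr (dotC z); ring.
under eq_fun do rewrite sE.
apply: is_derive_eq.
rewrite sE -[RHS]mulrC /z dotBr dotZr dotDr dotZr dotvv.
rewrite /GRing.scale/= !(mulr1,mulr0,addr0,add0r).
congr (_ * _); field.
by [].
Qed.

(** Differentiating the weight brings down a factor linear in x; [g] of linear growth keeps the
    product within reach of the second moment, and differentiation under the integral applies. *)
Lemma is_derive_pint g y h (a : R) : sublin g ->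
  is_derive a 1 (fun s => pint mu r g (y + s *: h))
    (pint mu r (fun x => g x * (r * dot h x)) (y + a *: h)
     - dot h (y + a *: h) * pint mu r g (y + a *: h)).
Proof.
move=> sg.
pose f (s : R) (x : B) := g x * postw r (y + s *: h) x.
pose df (s : R) (x : B) := g x *
  ((r * dot h x - dot h (y + s *: h)) * postw r (y + s *: h) x).
have fdf (s : R) (x : B) : is_derive s (1 : R) (f ^~ x) (df s x).
  have := is_deriveZ (g x) (is_derive_postw y h x s).
  by rewrite /f/df.
have d1E s x : partial1of2 f s x = df s x.
  by rewrite partial1of2E; exact: (@derive_val _ _ _ _ _ _ _ (fdf s x)).
(* For s within 1 of a, the factor [r * dot h x - dot h (y + s *: h)] is at most K (1 + |x|) in
   absolute value, and the weight is at most 1. *)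
pose K := enorm h * (`|r| + enorm y + (`|a| + 1) * enorm h).
have K0 : 0 <= K.
  by rewrite mulr_ge0 ?addr_ge0 ?mulr_ge0 ?addr_ge0 ?enorm_ge0.
pose G (x : B) := `|g x| * (K * (1 + enorm (x : V))).
have qG : quad G.
  have se : sublin (fun x : V => K * (1 + enorm x)).
    apply: sublinZ; apply: sublinD; first exact: sublin_cst.
    split; last first.
      by exists 1 => // x; rewrite mul1r ger0_norm ?enorm_ge0// lerDr.
    apply: (measurableT_comp (f := @Num.sqrt R)); last exact: measurable_sqn.
    by apply: continuous_measurable_fun; exact: sqrt_continuous.
  have sg' : sublin (fun x => `|g x|).
    case: sg => mg [C C0 gC]; split; first exact: measurableT_comp.
    by exists C => // x; rewrite normr_id.
  exact: sublinM.
have G0 x : 0 <= G x.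
  by rewrite /G mulr_ge0// mulr_ge0// addr_ge0// enorm_ge0.
have Ia : `]a - 1, a + 1[%classic a by rewrite /= in_itv/=; apply/andP; split; lra.
have intf s : `]a - 1, a + 1[%classic s -> mu.-integrable setT (EFin \o f s).
  by move=> _; apply: integrable_quad => //; apply: quad_postw; exact: sublin_quad.
have derf s x : `]a - 1, a + 1[%classic s -> setT x -> derivable (f ^~ x) s 1.
  by move=> _ _; exact: (@ex_derive _ _ _ _ _ _ _ (fdf s x)).
have Gub s x : `]a - 1, a + 1[%classic s -> setT x -> `|partial1of2 f s x| <= G x.
  rewrite /= in_itv/= => /andP[s1 s2] _; rewrite d1E /df /G normrM ler_wpM2l//.
  rewrite normrM (ger0_norm (ltW (postw_gt0 _ _ _))).
  apply: (@le_trans _ _ `|r * dot h x - dot h (y + s *: h)|).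
    by rewrite ler_piMr// postw_le1.
  have ns : `|s| <= `|a| + 1.
    by have := ler_norm a; have := ler_norm (- a); rewrite normrN ler_norml;
      move=> *; apply/andP; split; lra.
  apply: le_trans (ler_normB _ _) _.
  have h0 := enorm_ge0 h; have x0 := enorm_ge0 x; have y0 := enorm_ge0 y.
  have e1 : `|r * dot h x| <= enorm h * (`|r| * enorm x).
    by rewrite normrM mulrCA ler_wpM2l// norm_dot_le.
  have e2 : `|dot h (y + s *: h)| <= enorm h * (enorm y + (`|a| + 1) * enorm h).
    apply: le_trans (norm_dot_le _ _) _; rewrite ler_wpM2l//.
    by rewrite (le_trans (enormD _ _))// lerD2l enormZ ler_wpM2r.
  apply: le_trans (lerD e1 e2) _.
  rewrite -mulrDr /K -mulrA ler_wpM2l//.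
  rewrite -subr_ge0 (_ : _ - _ = `|r|
    + (enorm y + (`|a| + 1) * enorm h) * enorm x); last by ring.
  by rewrite addr_ge0// mulr_ge0// addr_ge0// mulr_ge0// addr_ge0.
have iG := integrable_quad mu2 qG.
have dF := derivable_under_integral (mu := mu) measurableT Ia intf derf G0 iG Gub.
have vF := differentiation_under_integral (mu := mu) measurableT Ia intf derf
  G0 iG Gub.
apply: DeriveDef; first exact: dF.
have -> : 'D_1 (fun s : R => pint mu r g (y + s *: h)) a =
   derive1 (fun s : R => \int[mu]_(x in setT) f s x) a by rewrite derive1E.
rewrite vF.
have qg := sublin_quad sg.
have qgh : quad (fun x => g x * (r * dot h x)).
  by apply: sublinM => //; apply: sublinZ; exact: sublin_dot.
rewrite -mulNr -pintZ// -pintD//; last exact: quadZ.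
apply: eq_Rintegral => x _; rewrite [LHS]d1E /df; ring.
Qed.

(** The term [dot h (y + a *: h)] multiplies numerator and evidence alike, so it cancels in the
    quotient rule and a covariance remains. *)
Lemma is_derive_postE_dot u y h (a : R) :
  is_derive a 1 (fun s => dot u (pmean mu r (y + s *: h)))
    (dot (u *m condcov mu r (y + a *: h)) h).
Proof.
under eq_fun do rewrite dot_pmean//.
have su : sublin (fun x => r * dot u x) by apply: sublinZ; exact: sublin_dot.
have sh : sublin (fun x => r * dot h x) by apply: sublinZ; exact: sublin_dot.
have dN := is_derive_pint y h a su.
have dD := is_derive_pint y h a (sublin_cst 1).
have e0 s : pint mu r (fun=> 1) (y + s *: h) != 0.
  by rewrite pint1 gt_eqF// evid_gt0.
have -> : (fun s => postE mu r (y + s *: h) (fun x => r * dot u x)) =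
    (fun s => pint mu r (fun x => r * dot u x) (y + s *: h)
      * (pint mu r (fun=> 1) (y + s *: h))^-1).
  by apply/funext => s; rewrite pint1.
have dV := @is_deriveV R (fun s : R => pint mu r (fun=> 1) (y + s *: h)) a _ 1 (e0 a) dD.
apply: (is_derive_eq (is_deriveM dN dV)).
rewrite condcov_form// /postE -!/(pint mu r _ _) -!/(evid mu r _) -!pint1.
have -> : pint mu r (fun x => 1 * (r * dot h x)) (y + a *: h) =
  pint mu r (fun x => r * dot h x) (y + a *: h).
  by congr pint; apply/funext => x; rewrite mul1r.
rewrite /GRing.scale/=; field; exact: e0.
Qed.

(** The mean value theorem is one for scalar functions: the direction [u] is fixed beforehand and
    the intermediate point depends on it. *)
Lemma pmean_mean_value u y h : exists2 c : R, 0 <= c <= 1 &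
  dot u (pmean mu r (y + h) - pmean mu r y)
  = dot (u *m condcov mu r (y + c *: h)) h.
Proof.
have dF (s : R) := is_derive_postE_dot u y h s.
have [c c01 cE] := @MVT R _ _ 0 1 ltr01 (fun s _ => dF s)
  (derivable_within_continuous (fun s _ => @ex_derive _ _ _ _ _ _ _ (dF s))).
exists c; first by move: c01; rewrite in_itv/= => /andP[c0 c1]; rewrite !ltW.
by rewrite dotBr; move: cE; rewrite scale1r scale0r addr0 subr0 mulr1.
Qed.

Lemma pmean_dot_le y h S : (forall c, 0 <= c <= 1 -> Lr mu r (y + c *: h) <= S) ->
  dot h (pmean mu r (y + h) - pmean mu r y) <= S * sqn h.
Proof.
move=> hS; have [c c01 ->] := pmean_mean_value h y h.
apply: le_trans (dot_mulmx_le _ _ _) _.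
by rewrite -mulrA -expr2 enorm_sqr ler_wpM2r ?sqn_ge0//; exact: hS.
Qed.

Lemma pmean_enorm_le y h S : (forall c, 0 <= c <= 1 -> Lr mu r (y + c *: h) <= S) ->
  enorm (pmean mu r (y + h) - pmean mu r y) <= S * enorm h.
Proof.
(* The increment is tested against itself and one factor of its norm is divided out. *)
move=> hS; set u := pmean mu r (y + h) - pmean mu r y.
have [c c01] := pmean_mean_value u y h; rewrite -/u dotvv -enorm_sqr => uE.
have : enorm u ^+ 2 <= S * enorm u * enorm h.
  rewrite uE; apply: le_trans (dot_mulmx_le _ _ _) _.
  by do 2 rewrite ler_wpM2r ?enorm_ge0//; exact: hS.
have S0 : 0 <= S by apply: le_trans (opnorm_ge0 _) (hS _ c01).
have [->|u0] := eqVneq (enorm u) 0; first by rewrite mulr_ge0 ?enorm_ge0.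
rewrite mulrAC expr2 ler_pM2r//.
by rewrite lt_def u0 enorm_ge0.
Qed.

End posterior_derivative.

(** * Continuity of the posterior and of L *)

Section posterior_continuity.
Context {R : realType} {d : nat}.
Local Notation V := 'rV[R]_d.
Local Notation B := (Rd R d).

Lemma continuous_sqn (f : V -> R) y e : {for y, continuous f} -> 0 < e ->
  exists2 del, 0 < del & forall y', sqn (y' - y) < del -> `|f y' - f y| < e.
Proof.
move=> cf e0; have : nbhs y (f @^-1` ball (f y) e).
  by apply: cf; exact: nbhsx_ballx.
move=> /nbhs_ballP[rho /= rho0 H]; exists (rho ^+ 2); first by rewrite exprn_gt0.
move=> y' yy'; rewrite distrC; apply: H; split => // i j.
rewrite (ord1 i) /ball/= distrC -(ltr_pXn2r (n := 2)) ?nnegrE ?(ltW rho0)//.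
rewrite real_normK ?num_real//; apply: le_lt_trans yy'.
by have := sqn_coord (y' - y) j; rewrite !mxE.
Qed.

(** By 1 - e^(-s) <= s the difference is at most e^(-|v|^2 / 2) times (v . h + |h|^2 / 2), and the
    Gaussian absorbs |v|. The bound does not depend on the base point, so it can be integrated
    against [mu]. *)
Lemma gauss_kernel_dist_le (z z' : V) :
  `|expR (- sqn z' / 2) - expR (- sqn z / 2)| <= enorm (z' - z) + sqn (z' - z).
Proof.
suff H (v w : V) : expR (- sqn v / 2) - expR (- sqn w / 2)
    <= enorm (w - v) + sqn (w - v).
  rewrite ler_norml; apply/andP; split; last first.
    apply: le_trans (H _ _) _.
    by rewrite /enorm !(sqnBC z z').
  by rewrite lerNl opprB; exact: H.
pose h := w - v; have -> : w = v + h by rewrite /h addrC subrK.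
rewrite addrAC subrr add0r sqnD.
set a := sqn v.
have ev : expR (- a / 2) * enorm v <= 1.
  rewrite -ler_pdivlMl ?expR_gt0// mulr1 -expRN.
  apply: le_trans (expR_ge1Dx _).
  have := sqr_ge0 (enorm v - 1); have : a = enorm v ^+ 2 by rewrite enorm_sqr.
  by move=> ->; rewrite sqrrB expr1n; lra.
have e1 : expR (- a / 2) <= 1.
  by rewrite -expR0 ler_expR mulNr oppr_le0 divr_ge0// sqn_ge0.
have -> : expR (- (a + 2 * dot v h + sqn h) / 2) =
    expR (- a / 2) * expR (- (dot v h + sqn h / 2)).
  by rewrite -expRD; congr expR; field.
set E := expR (- a / 2) in ev e1 *.
have E0 : 0 <= E by exact: expR_ge0.
apply: (@le_trans _ _ (E * (dot v h + sqn h / 2))).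
  rewrite -[X in X - _]mulr1 -mulrBr ler_wpM2l//.
  by have := expR_ge1Dx (- (dot v h + sqn h / 2)); lra.
rewrite mulrDr lerD//; last first.
  have := sqn_ge0 h => h0; apply: (@le_trans _ _ (1 * (sqn h / 2))); last lra.
  by rewrite ler_wpM2r// divr_ge0.
apply: le_trans (ler_wpM2l E0 (dot_le_enorm _ _)) _.
by rewrite mulrA -[leRHS]mul1r ler_wpM2r// enorm_ge0.
Qed.

Lemma continuous_enorm_dist (f : V -> R) (K : R) :
  (forall y y', `|f y' - f y| <= K * (enorm (y' - y) + sqn (y' - y))) ->
  continuous f.
Proof.
move=> fK; apply: continuous_sqnP => y e e0.
have K1 : 0 < 2 * (`|K| + 1) by rewrite mulr_gt0// ltr_wpDl.
(* Below 1 the square is dominated by the norm; [|K| + 1] is positive whatever the sign of K. *)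
pose t := Num.min 1 (e / (2 * (`|K| + 1))).
have t0 : 0 < t by rewrite lt_min ltr01 divr_gt0.
exists (t ^+ 2); first by rewrite exprn_gt0.
move=> y' yy'.
have ht : enorm (y' - y) < t.
  by rewrite -(ltr_pXn2r (n := 2)) ?nnegrE ?enorm_ge0 ?(ltW t0)// enorm_sqr.
have h0 := enorm_ge0 (y' - y).
have h1 : sqn (y' - y) <= enorm (y' - y).
  rewrite -enorm_sqr expr2 ler_piMl// ltW// (lt_le_trans ht)//.
  by rewrite ge_min lexx.
apply: le_lt_trans (fK _ _) _.
apply: (@le_lt_trans _ _ ((`|K| + 1) * (2 * enorm (y' - y)))).
  apply: (@le_trans _ _ ((`|K| + 1) * (enorm (y' - y) + sqn (y' - y)))).
    rewrite ler_wpM2r ?addr_ge0 ?sqn_ge0//.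
    by rewrite (le_trans (ler_norm K))// lerDl.
  by rewrite ler_wpM2l ?addr_ge0//; lra.
apply: (@lt_le_trans _ _ ((`|K| + 1) * (2 * t))).
  by rewrite ltr_pM2l ?ltr_pM2l// ltr_wpDl.
rewrite (_ : _ * (2 * t) = t * (2 * (`|K| + 1))); last by ring.
by rewrite -ler_pdivlMr// /t ge_min lexx orbT.
Qed.

Variables (mu : probability B R) (r : R).
Hypothesis mu2 : (\int[mu]_x (sqn x)%:E < +oo)%E.
Implicit Types (g : V -> R) (u y h : V).

Lemma continuous_pint g : quad g -> continuous (pint mu r g).
Proof.
move=> qg.
have qn : quad (fun x => `|g x|).
  apply: (quad_le (C := 1) qg) => //; last by move=> x; rewrite mul1r normr_id.
  by apply: measurableT_comp => //; exact: qg.1.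
apply: (continuous_enorm_dist (K := \int[mu]_x `|g x|)) => y y'.
set e := enorm _ + _.
have q1 z := quad_postw r z qg.
have qd : quad (fun x => g x * postw r y' x - g x * postw r y x) by exact: quadB.
rewrite /pint -RintegralB//; do ?[exact: integrable_quad].
apply: le_trans (le_normr_Rintegral _ _) _ => //; first exact: integrable_quad.
rewrite mulrC -RintegralZl//; last exact: integrable_quad.
apply: le_Rintegral => //.
- apply: integrable_quad => //; apply: (quad_le (C := 1) qd) => //.
    by apply: measurableT_comp => //; exact: qd.1.
  by move=> x; rewrite mul1r normr_id.
- by apply: integrable_quad => //; exact: quadZ.
move=> x _; rewrite -mulrBr normrM mulrC ler_wpM2r//.
have := gauss_kernel_dist_le (y - r *: x) (y' - r *: x).
have -> : y' - r *: x - (y - r *: x) = y' - y by rewrite opprB addrA subrK.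
by [].
Qed.

Lemma continuous_postE g : quad g -> continuous (fun y => postE mu r y g).
Proof.
move=> qg y.
have ce : {for y, continuous (evid mu r)}.
  have -> : evid mu r = pint mu r (fun=> 1).
    by apply/funext => z; rewrite pint1.
  have := continuous_pint (quad_cst 1).
  by move=> /(_ y).
have e0 : evid mu r y != 0 by rewrite gt_eqF//; exact: (evid_gt0 r mu2 y).
have := cvgM (continuous_pint qg (x := y)) (cvgV e0 ce).
exact.
Qed.

Lemma continuous_condcov i j : continuous (fun y => condcov mu r y i j).
Proof.
have sc k : sublin (fun x : V => r * x 0 k) by apply: sublinZ; exact: sublin_coord.
have qc k := sublin_quad (sc k).
under eq_fun do rewrite mxE.
move=> y; have := (cvgB (continuous_postE (sublinM (sc i) (sc j)) (x := y))
  (cvgM (continuous_postE (qc i) (x := y)) (continuous_postE (qc j) (x := y)))).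
exact.
Qed.

Lemma continuous_Lr : continuous (Lr mu r).
Proof.
apply: continuous_sqnP => y e e0.
(* The d^2 squared entries, each at most (e / (d + 1))^2, add up to less than e^2, also for d =
   0. *)
have e1 : 0 < e / d.+1%:R by rewrite divr_gt0.
have ex ij : exists del, 0 < del /\ forall y', sqn (y' - y) < del ->
    `|condcov mu r y' ij.1 ij.2 - condcov mu r y ij.1 ij.2| < e / d.+1%:R.
  have [del del0 H] := continuous_sqn (@continuous_condcov ij.1 ij.2 y) e1.
  by exists del.
have [del delP] := choice ex.
exists (\big[Num.min/1]_(ij : 'I_d * 'I_d) del ij).
  by apply: lt_bigmin => // ij _; exact: (delP ij).1.
move=> y' yy'.
apply: le_lt_trans (opnorm_dist_le _ _) _.
rewrite -[ltRHS]ger0_norm ?(ltW e0)// -sqrtr_sqr ltr_sqrt ?exprn_gt0//.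
apply: (@le_lt_trans _ _ (\sum_(i < d) \sum_(j < d) (e / d.+1%:R) ^+ 2)).
  apply: ler_sum => i _; apply: ler_sum => j _; rewrite mxE [X in _ + X]mxE.
  rewrite -[leLHS]real_normK ?num_real// ler_pXn2r ?nnegrE ?(ltW e1)//.
  have [_ H] := delP (i, j); apply/ltW/H; apply: lt_le_trans yy' _.
  exact: bigmin_le.
rewrite !sumr_const card_ord -mulrnA -[ltLHS]mulr_natr expr_div_n -mulrA.
rewrite gtr_pMr ?exprn_gt0// mulrC ltr_pdivrMr ?exprn_gt0// mul1r.
by rewrite expr2 -natrM ltr_nat ltn_mul.
Qed.

Lemma measurable_Lr : measurable_fun [set: B] (Lr mu r : B -> R).
Proof. by apply: continuous_measurable_Rd; exact: continuous_Lr. Qed.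

Lemma measurable_pmean : measurable_fun [set: B] (pmean mu r : B -> B).
Proof.
apply: measurable_fun_Rd => i; under eq_fun do rewrite mxE.
apply: continuous_measurable_Rd; apply: continuous_postE.
by apply: sublin_quad; apply: sublinZ; exact: sublin_coord.
Qed.

Lemma measurable_loss : measurable_fun [set: B] (loss mu r : B -> R).
Proof.
apply: measurableT_comp => //; apply: measurableT_comp; first exact: measurable_ln.
have -> : evid mu r = pint mu r (fun=> 1%R) by apply/funext => y; rewrite pint1.
by apply: continuous_measurable_Rd; apply: continuous_pint; exact: quad_cst.
Qed.

End posterior_continuity.

(** * Tweedie's formula *)

Section gradient.
Context {R : realType} {d : nat}.
Local Notation V := 'rV[R]_d.
Local Notation B := (Rd R d).

Lemma derive_line (f : V -> R) x v l :
  is_derive (0 : R) (1 : R) (fun s => f (x + s *: v)) l -> 'D_v f x = l.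
Proof.
move=> H; rewrite -(@derive_val _ _ _ _ _ _ _ H) /derive.
apply: (congr1 (fun F : R -> R => lim (F @ (0 : R)^'))).
apply/funext => h /=; rewrite scale0r addr0 addr0.
by rewrite [h *: v + x]addrC (_ : h *: (1 : R) = h) // /GRing.scale/= mulr1.
Qed.

Variables (mu : probability B R) (r : R).
Hypothesis mu2 : (\int[mu]_x (sqn x)%:E < +oo)%E.

(** The gradient of log Q at y is m(y) - y, by [is_derive_pint] with the constant 1. The logarithm
    removes the factor [c], and the chain rule produces the outer factor [k]. *)
Lemma grad_ln_evid (c k : R) (p : V -> R) (x : V) : 0 < c ->
  (forall y, p y = c * evid mu r (k *: y)) ->
  grad (fun y => ln (p y)) x = k *: (pmean mu r (k *: x) - k *: x).
Proof.
move=> c0 pE; apply/rowP => i; rewrite mxE.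
set h := k *: delta_mx 0 i : V; pose y := k *: x.
have e0 s : 0 < pint mu r (fun=> 1) (y + s *: h) by rewrite pint1 evid_gt0.
have dD := is_derive_pint r mu2 y h 0 (sublin_cst 1).
have dc := is_deriveZ c dD.
have dl := @is_derive1_comp _ (@ln R) _ 0 _ _ (is_derive1_ln (mulr_gt0 c0 (e0 0))) dc.
suff Hd : is_derive (0 : R) (1 : R)
    (fun s : R => ln (p (x + s *: delta_mx 0 i))) (dot h (pmean mu r y - y)).
  rewrite (derive_line Hd) /h dotZl mxE; congr (_ * _).
  rewrite /dot (bigD1 i)//= big1 ?addr0; last first.
    by move=> j ji; rewrite mxE (negbTE ji) andbF mul0r.
  by rewrite mxE !eqxx mul1r.
have -> : (fun s : R => ln (p (x + s *: delta_mx 0 i))) =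
    (@ln R) \o (c \*: (fun s => pint mu r (fun=> 1) (y + s *: h))).
  apply/funext => s /=; rewrite pE pint1; congr (ln (c * evid mu r _)).
  by rewrite scalerDr /h !scalerA mulrC.
apply: (is_derive_eq dl).
rewrite dotBr dot_pmean// /postE -/(pint mu r _ y) -/(evid mu r y) -pint1.
have -> : pint mu r (fun x => 1 * (r * dot h x)) (y + 0 *: h) =
  pint mu r (fun x => r * dot h x) y.
  by rewrite scale0r addr0; congr pint; apply/funext => z; rewrite mul1r.
have := e0 0; rewrite scale0r addr0 => ey.
rewrite /GRing.scale/=; field; rewrite !gt_eqF//.
Qed.

End gradient.

(** * Local suprema of L and a majorant for them *)

Section local_sup.
Context {R : realType} {d : nat}.
Local Notation V := 'rV[R]_d.
Local Notation B := (Rd R d).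
Variables (mu : probability B R) (r : R).
Hypothesis mu2 : (\int[mu]_x (sqn x)%:E < +oo)%E.

(** Here [rho] is a squared radius, to be compared directly with [sqn (T x - x)]. *)
Definition Lsup (rho : R) (y : V) : R :=
  sup [set Lr mu r (y + xi) | xi in [set xi : V | sqn xi <= rho]].

(** The bound 4 d loss at a shifted point, with the loss there replaced by |xi|^2 + 2 loss and
    |xi|^2 by 1. It is the same for all [rho] up to 1. *)
Definition envelope (y : V) : R := 4 * d%:R * (1 + 2 * loss mu r y).

Lemma Lsup_ub rho y : rho <= 1 ->
  ubound [set Lr mu r (y + xi) | xi in [set xi : V | sqn xi <= rho]] (envelope y).
Proof.
move=> rho1 _ [xi /= xir <-]; apply: le_trans (Lr_le_loss _ mu2 _) _.
rewrite ler_wpM2l ?mulr_ge0//.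
by rewrite (le_trans (loss_shift_le r mu2 y xi))// lerD2r (le_trans xir).
Qed.

Lemma Lr_le_Lsup rho y xi : rho <= 1 -> sqn xi <= rho ->
  Lr mu r (y + xi) <= Lsup rho y.
Proof.
move=> rho1 xir; apply: ub_le_sup; last by exists xi.
by exists (envelope y); exact: Lsup_ub.
Qed.

Lemma Lsup_nonempty (rho : R) y : 0 <= rho ->
  [set Lr mu r (y + xi) | xi in [set xi : V | sqn xi <= rho]] !=set0.
Proof. by move=> rho0; exists (Lr mu r (y + 0)); exists 0 => //=; rewrite sqn0. Qed.

Lemma Lsup_le_envelope rho y : 0 <= rho <= 1 -> Lsup rho y <= envelope y.
Proof.
by move=> /andP[rho0 rho1]; apply: ge_sup; [exact: Lsup_nonempty|exact: Lsup_ub].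
Qed.

Lemma Lsup_ge0 rho y : 0 <= rho <= 1 -> 0 <= Lsup rho y.
Proof.
move=> /andP[rho0 rho1]; apply: le_trans (opnorm_ge0 _) _.
by apply: (@Lr_le_Lsup rho y 0 rho1); rewrite sqn0.
Qed.

(* [Lsup > a] is a union of translates of the open set [Lr > a]. *)
Lemma measurable_Lsup rho : 0 <= rho <= 1 ->
  measurable_fun [set: B] (Lsup rho : B -> R).
Proof.
move=> /andP[rho0 rho1].
apply: (measurability _ (measurable_realfun.RGenOInfty.measurableE R)).
move=> _ [_ [a ->] <-]; rewrite setTI; apply: open_measurable_Rd.
rewrite (_ : _ @^-1` _ = \bigcup_(xi in [set xi : V | sqn xi <= rho])
    [set y : V | a < Lr mu r (y + xi)]).
  apply: bigcup_open => xi _.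
  have cL : continuous (fun y : V => Lr mu r (y + xi)).
    apply: continuous_sqnP => y e e0.
    have [del del0 H] := continuous_sqn (@continuous_Lr _ _ mu r mu2 (y + xi)) e0.
    exists del => // y' yy'; apply: H.
    by rewrite opprD addrACA subrr addr0.
  move/continuousP : cL => /(_ `]a, +oo[%classic).
  rewrite (_ : [set _ | _] = (fun y : V => Lr mu r (y + xi)) @^-1` `]a, +oo[%classic).
    by apply; exact: interval_open.
  by apply/seteqP; split => z /=; rewrite in_itv/= andbT.
apply/seteqP; split => y /=; rewrite in_itv/= andbT.
  by move=> /(sup_gt (Lsup_nonempty _ rho0))[_ [xi xir <-] axi]; exists xi.
by move=> [xi /= xir axi]; exact: lt_le_trans axi (Lr_le_Lsup _ rho1 xir).
Qed.

Lemma cvg_Lsup y : Lsup n.+1%:R^-1 y @[n --> \oo] --> Lr mu r y.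
Proof.
apply/cvgrPdist_le => e e0.
have [del del0 H] := continuous_sqn (@continuous_Lr _ _ mu r mu2 y) e0.
pose N := Num.truncn (del^-1).
have HN n : (N <= n)%N -> n.+1%:R^-1 < del.
  move=> Nn; rewrite invf_plt ?posrE//.
  by rewrite (lt_le_trans (truncnS_gt _))// ler_nat ltnS.
exists N => // n /= Nn.
have n01 : 0 <= (n.+1%:R^-1 : R) <= 1.
  by rewrite invr_ge0 ler0n/= invf_le1 ?ler1n.
have /andP[n0 n1] := n01.
rewrite distrC ler_norml; apply/andP; split.
  have := @Lr_le_Lsup n.+1%:R^-1 y 0 n1; rewrite sqn0 addr0 => /(_ n0) H1.
  by rewrite lerBrDr (le_trans _ H1)// gerDr oppr_le0 ltW.
rewrite lerBlDr; apply: ge_sup; first exact: Lsup_nonempty.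
move=> _ [xi /= xir <-].
have : `|Lr mu r (y + xi) - Lr mu r y| < e.
  by apply: H; rewrite addrAC subrr add0r (le_lt_trans xir)//; exact: HN.
by rewrite ltr_norml => /andP[_ /ltW]; rewrite lerBlDr.
Qed.

End local_sup.

(** * The law of the Ornstein-Uhlenbeck process *)

Section boxes.
Local Open Scope ereal_scope.
Context {R : realType} {d : nat}.
Local Notation V := 'rV[R]_d.
Local Notation B := (Rd R d).

(** A ball of the maximum norm: its indicator is a product over the coordinates, so its iterated
    integral is explicit. *)
Definition box (y : V) (e : R) : set V :=
  [set x | forall i, (`|x 0%R i - y 0%R i| <= e)%R].

Lemma box_indic (y x : V) e : \1_(box y e) x =
  (\prod_i \1_[set s | `|s - y 0 i| <= e] (x 0 i))%R :> R.
Proof.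
have [xb|xb] := pselect (box y e x).
  rewrite indicE mem_set// big1// => i _.
  by rewrite indicE mem_set//; exact: xb.
rewrite indicE memNset//; have /existsNP[i xi] := xb.
by rewrite (bigD1 i)//= indicE memNset ?mul0r.
Qed.

Lemma measurable_box (y : V) e : measurable (box y e : set B).
Proof.
rewrite (_ : box y e = \bigcap_(i in [set: 'I_d])
  ((fun x : B => (x : V) 0%R i) @^-1` [set s | (`|s - y 0%R i| <= e)%R])).
  apply: fin_bigcap_measurable => // i _; rewrite -[X in measurable X]setTI.
  apply: measurable_coord => //.
  rewrite (_ : [set _ | _] = `[(y 0 i - e)%R, (y 0 i + e)%R]%classic)//.
  by apply/seteqP; split => s /=; rewrite in_itv/= ler_distl.
by apply/seteqP; split => x /= xb i; [move=> _; exact: xb|exact: xb].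
Qed.

Lemma leb_int_box (y : V) (e : R) : (0 < e)%R ->
  leb_int (fun x : V => (\1_(box y e) x)%:E) = ((2 * e) ^+ d)%:E.
Proof.
move=> e0; pose phi (i : 'I_d) (s : R) := \1_[set s | (`|s - y 0 i| <= e)%R] s : R.
have phiE i : [set s | (`|s - y 0%R i| <= e)%R]
    = `[(y 0 i - e)%R, (y 0 i + e)%R]%classic.
  by apply/seteqP; split => s /=; rewrite in_itv/= ler_distl.
rewrite (_ : (fun _ => _) = fun x : V => (\prod_i phi i (x 0%R i))%:E); last first.
  by apply/funext => x; rewrite box_indic.
rewrite (@leb_int_prod _ _ phi (fun=> (2 * e)%R)) ?prodr_const ?card_ord//.
- by move=> i; apply: measurable_indic; rewrite phiE.
move=> i; rewrite /phi phiE integral_indic// setIT.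
apply: etrans (lebesgue_measure_itv `[(y 0 i - e)%R, (y 0 i + e)%R]) _ => /=.
rewrite lte_fin ifT; last by lra.
by rewrite -EFinB; congr EFin; ring.
Qed.

(** A function within [del] of [c] on the box integrates to [c] times the volume, up to [del] times
    the volume. The lower bound is stated with a sum, as the integrals are extended reals. *)
Lemma leb_int_box_near (f : V -> R) (z : V) (e c del : R) :
  measurable_fun [set: B] (f : B -> R) -> (forall x, 0 <= f x)%R ->
  (0 < e)%R -> (0 <= c)%R -> (0 <= del)%R ->
  (forall x, box z e x -> `|f x - c| <= del)%R ->
  leb_int (fun x : V => (f x * \1_(box z e) x)%:E) <= ((c + del) * (2 * e) ^+ d)%:E
  /\ (c * (2 * e) ^+ d)%:E <=
     leb_int (fun x : V => (f x * \1_(box z e) x)%:E) + (del * (2 * e) ^+ d)%:E.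
Proof.
move=> mf f0 e0 c0 del0 fc.
have mi : measurable_fun [set: B] (fun x : B => (\1_(box z e) (x : V))%:E : \bar R).
  by apply/measurable_EFinP; apply: measurable_indic; exact: measurable_box.
have i0 (x : V) : 0 <= (\1_(box z e) x)%:E :> \bar R by rewrite lee_fin.
have mfi : measurable_fun [set: B]
    (fun x : B => (f x * \1_(box z e) (x : V))%:E : \bar R).
  apply/measurable_EFinP; apply: measurable_funM => //.
  by apply: measurable_indic; exact: measurable_box.
have fi0 (x : V) : 0 <= (f x * \1_(box z e) x)%:E by rewrite lee_fin mulr_ge0.
have Z k : (0 <= k)%R -> leb_int (fun x : V => k%:E * (\1_(box z e) x)%:E) =
    (k * (2 * e) ^+ d)%:E.
  by move=> k0; rewrite /leb_int iter_lebZ// -/(leb_int _) leb_int_box.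
rewrite -!Z ?addr_ge0//; split.
  apply: le_iter_leb => //; first exact: measurable_funeM.
  move=> x; rewrite -EFinM lee_fin indicE; case: (boolP (x \in _)).
    rewrite inE => xb; rewrite !mulr1.
    by have := fc _ xb; rewrite ler_distl => /andP[_]; lra.
  by move=> _; rewrite !mulr0.
rewrite /leb_int -iter_lebD//; last 2 first.
  by move=> x; rewrite mule_ge0// lee_fin.
  exact: measurable_funeM.
apply: le_iter_leb => //.
- by move=> x; rewrite mule_ge0// lee_fin.
- exact: measurable_funeM.
- by apply: emeasurable_funD => //; exact: measurable_funeM.
move=> x; rewrite -!EFinM -EFinD lee_fin indicE; case: (boolP (x \in _)).
  rewrite inE => xb; rewrite !mulr1.
  by have := fc _ xb; rewrite ler_distl => /andP[+ _]; lra.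
by move=> _; rewrite !mulr0 addr0.
Qed.

(** An integrable majorant for Gaussian tails which is a product over the coordinates. *)
Definition laplace (y : V) : R := expR (- (\sum_i `|y 0 i|) / 2).

Lemma measurable_laplace : measurable_fun [set: B] (laplace : B -> R).
Proof.
apply: measurableT_comp => //; apply: measurable_funM => //.
apply: measurableT_comp => //; apply: measurable_sum => i.
by apply: measurableT_comp => //; exact: measurable_coord.
Qed.

(** Twice the integral over the half-line, where the integrand is twice the exponential density of
    rate 1/2. *)
Let abs_expR_integral :
  \int[@lebesgue_measure R]_s (expR (- `|s| / 2))%:E = 4%:E.
Proof.
rewrite ge0_symfun_integralT; last 3 first.
- by move=> s; exact: expR_ge0.
- move=> s; apply: continuous_comp; last exact: continuous_expR.
  apply: cvgM; last exact: cvg_cst.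
  by apply: cvgN; exact: norm_continuous.
- by move=> s /=; rewrite normrN.
have h0 : (0 < 2^-1 :> R)%R by rewrite invr_gt0.
have -> : [set x : R | (0 <= x)%R] = `[0%R, +oo[%classic by rewrite set_itvcy.
rewrite integral_mkcond.
rewrite (_ : _ \_ _ = fun s => 2%:E * (exponential_pdf 2^-1 s)%:E); last first.
  apply/funext => s; rewrite /exponential_pdf /= !patchE.
  case: ifPn; last by rewrite mule0.
  rewrite inE/= in_itv/= andbT => s0; rewrite -EFinM ger0_norm//.
  by congr EFin; rewrite mulrA divff// mul1r; congr expR; field.
rewrite ge0_integralZl//; last 2 first.
  by apply/measurable_EFinP; exact: measurable_exponential_pdf.
  by move=> s _; rewrite lee_fin exponential_pdf_ge0// ltW.
by rewrite integral_exponential_pdf// mule1 -EFinM; congr EFin; ring.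
Qed.

Lemma leb_int_laplace : leb_int (fun y : V => (laplace y)%:E) = (4 ^+ d)%:E.
Proof.
rewrite (_ : (fun _ => _) =
    fun y : V => (\prod_i expR (- `|y 0 i| / 2))%:E); last first.
  apply/funext => y; rewrite /laplace -expR_sum; congr (expR _)%:E.
  by rewrite -mulr_suml sumrN.
pose phi (i : 'I_d) (s : R) := expR (- `|s| / 2).
have phi0 i s : (0 <= phi i s)%R by exact: expR_ge0.
have mphi i : measurable_fun [set: R] (phi i).
  apply: measurableT_comp => //; apply: measurable_funM => //.
  by apply: measurableT_comp => //; exact: measurable_normr.
rewrite (@leb_int_prod _ _ phi (fun=> 4%R) phi0 mphi (fun=> abs_expR_integral)).
by rewrite prodr_const card_ord.
Qed.

Local Open Scope ring_scope.

(** The exponent |z|^2 / 2 is halved: one half absorbs 1 + |z|^2 <= 4 e^(|z|^2 / 4), the other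
    dominates the [laplace] exponent through |z_i| <= (z_i^2 + 1) / 2, at the price of e^(d / 4). *)
Lemma gauss_le_laplace (z : V) :
  gauss 1 z * (1 + sqn z) <= gauss 1 (0 : V) * (4 * expR (d%:R / 4)) * laplace z.
Proof.
rewrite /gauss sqn0 oppr0 mul0r expR0 mulr1 expr1n mulr1 -!mulrA.
rewrite ler_wpM2l ?exprn_ge0 ?invr_ge0 ?sqrtr_ge0//.
apply: (@le_trans _ _ (4 * expR (- sqn z / 4))).
  rewrite mulr1.
  have -> : expR (- sqn z / 2) = (expR (- sqn z / 4) * expR (- sqn z / 4))%R.
    by rewrite -expRD; congr expR; field.
  rewrite -mulrA mulrC ler_wpM2r ?expR_ge0//.
  have -> : expR (- sqn z / 4) = (expR (sqn z / 4))^-1 by rewrite -expRN mulNr.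
  rewrite ler_pdivrMl ?expR_gt0//.
  by have := expR_ge1Dx (sqn z / 4); lra.
rewrite ler_wpM2l// /laplace -expRD ler_expR.
have h : (\sum_i `|z 0 i| <= (sqn z + d%:R) / 2)%R.
  have -> : (sqn z + d%:R = \sum_i ((z 0 i) ^+ 2 + 1))%R.
    by rewrite big_split/= sumr_const card_ord.
  rewrite mulr_suml; apply: ler_sum => i _.
  have := sqr_ge0 (`|z 0 i| - 1).
  by rewrite sqrrB real_normK ?num_real// expr1n; lra.
lra.
Qed.

End boxes.

(** * Integrals against mu_t, bounded by iterated integrals *)

Section ou_law.
Local Open Scope ereal_scope.
Context {R : realType} {d : nat}.
Local Notation V := 'rV[R]_d.
Local Notation B := (Rd R d).

Lemma integral_EFin_Rintegral dT (T : measurableType dT)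
    (m : {measure set T -> \bar R}) (f : T -> R) :
  m.-integrable [set: T] (EFin \o f) ->
  \int[m]_x (f x)%:E = (\int[m]_x f x)%R%:E.
Proof. by move=> mf; rewrite /Rintegral fineK//; exact: integrable_fin_num. Qed.

Lemma gauss1E (z : V) : gauss 1 z = (gauss 1 (0 : V) * expR (- sqn z / 2))%R.
Proof. by rewrite /gauss sqn0 oppr0 mul0r expR0 mulr1 expr1n !mulr1. Qed.

Lemma gauss0_gt0 : (0 < gauss 1 (0 : V))%R.
Proof.
rewrite /gauss sqn0 oppr0 mul0r expR0 mulr1 exprn_gt0// invr_gt0 sqrtr_gt0.
by rewrite expr1n mulr1 mulr_gt0// pi_gt0.
Qed.

Lemma gauss_ge0 (s : R) (z : V) : (0 <= gauss s z)%R.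
Proof. by rewrite mulr_ge0 ?expR_ge0// exprn_ge0// invr_ge0 sqrtr_ge0. Qed.

Lemma measurable_gauss (s : R) : measurable_fun [set: B] (gauss s : B -> R).
Proof.
apply: measurable_funM => //; apply: measurableT_comp => //.
apply: measurable_funM => //; apply: measurableT_comp => //.
exact: measurable_sqn.
Qed.

Lemma measurable_affine (a s : R) : measurable_fun [set: (B * B)%type]
  (fun w => (a *: (w.1 : V) + s *: (w.2 : V))%R : B).
Proof.
apply: measurable_fun_Rd => i; under eq_fun do rewrite !mxE.
apply: measurable_funD; apply: measurable_funM => //.
  exact: measurableT_comp (measurable_coord i) measurable_fst.
exact: measurableT_comp (measurable_coord i) measurable_snd.
Qed.

Variables (mu mut : probability B R) (p : V -> R) (a sg : R).
Hypothesis mu2 : \int[mu]_x (sqn x)%:E < +oo.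
Hypothesis sg0 : (0 < sg)%R.
Hypothesis mutE : forall A : set B, measurable A -> mut A =
  \int[mu]_x leb_int (fun z => (gauss 1 z * \1_A (a *: (x : V) + sg *: z))%:E).
Hypothesis dp : is_density mut p.
Hypothesis cp : continuous p.

Let p0 x : (0 <= p x)%R. Proof. by case: dp. Qed.

Let mp : measurable_fun [set: B] (p : B -> R). Proof. by case: dp => _ []. Qed.

Definition ou_fun (f : B -> \bar R) (w : (B * B)%type) : \bar R :=
  (gauss 1 (w.2 : V))%:E * f (a *: (w.1 : V) + sg *: (w.2 : V))%R.

Lemma ou_fun_ge0 f w : (forall x, 0 <= f x) -> 0 <= ou_fun f w.
Proof. by move=> f0; rewrite mule_ge0// lee_fin gauss_ge0. Qed.

Lemma measurable_ou_fun f : measurable_fun [set: B] f ->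
  measurable_fun [set: (B * B)%type] (ou_fun f).
Proof.
move=> mf; apply: emeasurable_funM.
  apply/measurable_EFinP.
  exact: (measurableT_comp (measurable_gauss 1) measurable_snd).
exact: (measurableT_comp mf (measurable_affine a sg)).
Qed.

Lemma measurable_ou_fun2 f x : measurable_fun [set: B] f ->
  measurable_fun [set: B] (fun z : B => ou_fun f (x, z)).
Proof. by move=> mf; exact: measurable_fun_pair2 (measurable_ou_fun mf). Qed.

Lemma measurable_ou_leb f : (forall x, 0 <= f x) -> measurable_fun [set: B] f ->
  measurable_fun [set: B] (fun x : B => leb_int (fun z : V => ou_fun f (x, z))).
Proof.
move=> f0 mf; apply: measurable_leb_int; last exact: measurable_ou_fun.
by move=> w; exact: ou_fun_ge0.
Qed.

(** The right-hand side is a monotone additive functional of [f] that agrees with [mut] on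
    indicators, where [mutE] applies. *)
Lemma integral_le_ou (f : B -> \bar R) : (forall x, 0 <= f x) ->
  measurable_fun [set: B] f ->
  \int[mut]_x f x <= \int[mu]_x leb_int (fun z : V => ou_fun f (x, z)).
Proof.
move=> f0 mf.
apply: (@integral_le_functional R _ B mut
  (fun f => \int[mu]_x leb_int (fun z : V => ou_fun f (x, z)))) => //.
- move=> A mA; rewrite [leLHS](mutE mA) le_eqVlt; apply/orP; left; apply/eqP.
  by apply: eq_integral => x _; congr leb_int; apply/funext => z; rewrite EFinM.
- move=> g g0; apply: integral_ge0 => x _; apply: leb_int_ge0 => z.
  exact: ou_fun_ge0.
- move=> k g k0 g0 mg; rewrite -ge0_integralZl//; last 2 first.
    exact: measurable_ou_leb.
    by move=> x _; apply: leb_int_ge0 => z; exact: ou_fun_ge0.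
  rewrite le_eqVlt; apply/orP; left; apply/eqP; apply: eq_integral => x _.
  rewrite /leb_int -iter_lebZ//; last 2 first.
    by move=> z; exact: ou_fun_ge0.
    exact: measurable_ou_fun2.
  by congr iter_leb; apply/funext => z; rewrite /ou_fun muleCA.
- move=> g h g0 h0 mg mh; rewrite -ge0_integralD//; last 4 first.
    by move=> x _; apply: leb_int_ge0 => z; exact: ou_fun_ge0.
    exact: measurable_ou_leb.
    by move=> x _; apply: leb_int_ge0 => z; exact: ou_fun_ge0.
    exact: measurable_ou_leb.
  rewrite le_eqVlt; apply/orP; left; apply/eqP; apply: eq_integral => x _.
  rewrite /leb_int -iter_lebD//; last 4 first.
    by move=> z; exact: ou_fun_ge0.
    exact: measurable_ou_fun2.
    by move=> z; exact: ou_fun_ge0.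
    exact: measurable_ou_fun2.
  by congr iter_leb; apply/funext => z; rewrite /ou_fun ge0_muleDr.
- move=> g h g0 mg mh gh.
  have h0 x : 0 <= h x by exact: le_trans (gh x).
  apply: ge0_le_integral => //.
  + by move=> x _; apply: leb_int_ge0 => z; exact: ou_fun_ge0.
  + exact: measurable_ou_leb.
  + exact: measurable_ou_leb.
  move=> x _; apply: le_iter_leb.
  + by move=> z; exact: ou_fun_ge0.
  + exact: measurable_ou_fun2.
  + exact: measurable_ou_fun2.
  by move=> z; rewrite lee_wpmul2l// lee_fin gauss_ge0.
Qed.

Lemma integral_le_density (f : B -> \bar R) : (forall x, 0 <= f x) ->
  measurable_fun [set: B] f ->
  \int[mut]_x f x <= leb_int (fun x : V => (p x)%:E * f x).
Proof.
move=> f0 mf.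
have mpf g : measurable_fun [set: B] g ->
    measurable_fun [set: B] (fun x : B => (p x)%:E * g x).
  by move=> mg; apply: emeasurable_funM => //; exact/measurable_EFinP.
have pf0 g : (forall x : B, 0 <= g x) -> forall x : B, 0 <= (p x)%:E * g x.
  by move=> g0 x; rewrite mule_ge0// lee_fin.
apply: (@integral_le_functional R _ B mut
  (fun f => leb_int (fun x : V => (p x)%:E * f x))) => //.
- move=> A mA; rewrite [leLHS](dp.2.2 A mA).
  by under [in leLHS]eq_fun do rewrite EFinM.
- by move=> g g0; apply: leb_int_ge0; exact: pf0.
- move=> k g k0 g0 mg; rewrite /leb_int -iter_lebZ//; [|exact: pf0|exact: mpf].
  by under [in leLHS]eq_fun do rewrite muleCA.
- move=> g h g0 h0 mg mh; rewrite /leb_int -iter_lebD//;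
    do ?[exact: pf0|exact: mpf].
  rewrite le_eqVlt; apply/orP; left; apply/eqP; congr iter_leb.
  by apply/funext => z; rewrite ge0_muleDr.
- move=> g h g0 mg mh gh; apply: le_iter_leb; do ?[exact: pf0|exact: mpf].
  by move=> x; rewrite lee_wpmul2l// lee_fin.
Qed.

End ou_law.

(** * The density of mu_t in terms of the evidence *)

Section ou_density.
Local Open Scope ereal_scope.
Context {R : realType} {d : nat}.
Local Notation V := 'rV[R]_d.
Local Notation B := (Rd R d).
Variables (mu mut : probability B R) (p : V -> R) (a sg : R).
Hypothesis mu2 : \int[mu]_x (sqn x)%:E < +oo.
Hypothesis sg0 : (0 < sg)%R.
Hypothesis mutE : forall A : set B, measurable A -> mut A =
  \int[mu]_x leb_int (fun z => (gauss 1 z * \1_A (a *: (x : V) + sg *: z))%:E).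
Hypothesis dp : is_density mut p.
Hypothesis cp : continuous p.

Let g1 : R := gauss 1 (0 : V).
Let q (y : V) : R := (g1 * evid mu (a / sg) (sg^-1 *: y))%R.

(** Scaling and translation turn boxes into boxes, so the substitution can be made in the indicator
    instead of the integral. *)
Let box_affine (y x z : V) (e : R) :
  \1_(box y e) (a *: x + sg *: z)%R =
  \1_(box (sg^-1 *: y - (a / sg) *: x)%R (e / sg)) z :> R.
Proof.
have H i : (`|(a *: x + sg *: z) 0 i - y 0 i| =
    sg * `|z 0 i - (sg^-1 *: y - (a / sg) *: x) 0 i|)%R.
  rewrite -{2}(gtr0_norm sg0) -normrM !mxE; congr (`|_|)%R.
  by field; rewrite gt_eqF.
rewrite !indicE; congr ((_ : bool)%:R)%R; apply/idP/idP; rewrite !inE => h i.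
  by rewrite ler_pdivlMr// mulrC -H; exact: h.
by rewrite H mulrC -ler_pdivlMr//; exact: h.
Qed.

Let box_sqn_le (z0 z : V) (e : R) : (0 <= e)%R -> box z0 e z ->
  (sqn (z - z0) <= d%:R * e ^+ 2)%R.
Proof.
move=> e0 zb; rewrite mulr_natl -[X in (_ *+ X)%R]card_ord -sumr_const.
apply: ler_sum => i _; rewrite !mxE -[leLHS]real_normK ?num_real//.
by rewrite ler_pXn2r ?nnegrE//; exact: zb.
Qed.

Let mut_box_density (y : V) (e th : R) : (0 < e)%R -> (0 <= th)%R ->
  (forall x, box y e x -> `|p x - p y| <= th)%R ->
  mut (box y e) <= ((p y + th) * (2 * e) ^+ d)%:E /\
  (p y * (2 * e) ^+ d)%:E <= mut (box y e) + (th * (2 * e) ^+ d)%:E.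
Proof.
move=> e0 th0 H; have [pge0 [mp dE]] := dp.
by rewrite (dE _ (measurable_box y e)); exact: leb_int_box_near.
Qed.

(** On the box of half-width e' = e / sg the Gaussian deviates from its central value by at most g1
    (|h| + |h|^2) with |h| <= (d + 1) e'. As e' <= 1, both terms are at most (d + 1)^2 e', whence
    the constant. The bound is uniform in x, and the central values integrate to [q y]. *)
Let mut_box_ou (y : V) (e th : R) : (0 < e)%R -> (e <= sg)%R -> (0 <= th)%R ->
  (g1 * (2 * d.+1%:R ^+ 2) * (e / sg) <= th)%R ->
  mut (box y e) <= ((q y + th) * (2 * (e / sg)) ^+ d)%:E /\
  (q y * (2 * (e / sg)) ^+ d)%:E <=
  mut (box y e) + (th * (2 * (e / sg)) ^+ d)%:E.
Proof.
move=> e0 esg th0 eth.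
set e' := (e / sg)%R in eth *.
have e'0 : (0 < e')%R by rewrite divr_gt0.
have e'1 : (e' <= 1)%R by rewrite ler_pdivrMr// mul1r.
set v := ((2 * e') ^+ d)%R.
have v0 : (0 <= v)%R by rewrite exprn_ge0// mulr_ge0// ltW.
have g10 : (0 < g1)%R by exact: gauss0_gt0.
pose r := (a / sg)%R; pose y' := (sg^-1 *: y)%R.
pose c (x : V) : R := (g1 * postw r y' x)%R.
have c0 x : (0 <= c x)%R by rewrite mulr_ge0// ltW// postw_gt0.
pose F (x : B) := leb_int (fun z : V =>
  (gauss 1 z * \1_(box y e) (a *: (x : V) + sg *: z))%:E).
have near x : F x <= ((c x + th) * v)%:E /\ (c x * v)%:E <= F x + (th * v)%:E.
  rewrite /F; under eq_fun do rewrite box_affine.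
  apply: leb_int_box_near => //.
  - exact: measurable_gauss.
  - by move=> z; exact: gauss_ge0.
  move=> z zb; rewrite gauss1E -/g1 /c -mulrBr normrM gtr0_norm//.
  apply: le_trans eth; rewrite -mulrA ler_wpM2l ?(ltW g10)//.
  apply: le_trans (gauss_kernel_dist_le _ _) _.
  have := box_sqn_le (ltW e'0) zb; rewrite -/r -/y' => sq.
  have D0 : (d%:R <= d.+1%:R ^+ 2 :> R)%R.
    by rewrite -natrX ler_nat (leq_trans (leqnSn d))// expnS expn1 leq_pmulr//.
  have sq1 : (sqn (z - (y' - r *: x)) <= (d.+1%:R * e') ^+ 2)%R.
    by rewrite (le_trans sq)// [leRHS]exprMn ler_wpM2r// sqr_ge0.
  have en : (enorm (z - (y' - r *: x)) <= d.+1%:R * e')%R.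
    have De0 : (0 <= d.+1%:R * e')%R by rewrite mulr_ge0 ?(ltW e'0).
    by rewrite /enorm -[leRHS](ger0_norm De0) -sqrtr_sqr ler_wsqrtr.
  apply: le_trans (lerD en sq1) _.
  have De1 : (d.+1%:R * e' <= d.+1%:R ^+ 2 * e')%R.
    by rewrite ler_wpM2r ?(ltW e'0)// expr2 ler_peMl// ler1n.
  have De2 : ((d.+1%:R * e') ^+ 2 <= d.+1%:R ^+ 2 * e')%R.
    by rewrite [leLHS]exprMn ler_wpM2l ?sqr_ge0// expr2 ler_piMl// ltW.
  apply: le_trans (lerD De1 De2) _.
  by rewrite le_eqVlt; apply/orP; left; apply/eqP; ring.
have F0 x : 0 <= F x.
  by apply: leb_int_ge0 => z; rewrite lee_fin mulr_ge0// gauss_ge0.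
have mF : measurable_fun [set: B] F.
  have -> : F = fun x : B => leb_int (fun z : V =>
      ou_fun a sg (fun x : B => (\1_(box y e) (x : V))%:E) (x, z)).
    by apply/funext.
  apply: measurable_ou_leb; first by move=> x; rewrite lee_fin.
  by apply/measurable_EFinP; apply: measurable_indic; exact: measurable_box.
have FE : mut (box y e) = \int[mu]_x F x by rewrite mutE//; exact: measurable_box.
have qc k : (0 <= k)%R -> quad (fun x => (c x + k) * v)%R.
  move=> k0; rewrite (_ : (fun _ => _) = fun x => (v * (c x + k)))%R; last first.
    by apply/funext => x; rewrite mulrC.
  apply: quadZ; apply: quadD; last exact: quad_cst.
  by apply: quadZ; exact: quad1_postw.
have intc k : (0 <= k)%R ->
    \int[mu]_x ((c x + k) * v)%:E = ((q y + k) * v)%:E.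
  move=> k0; rewrite integral_EFin_Rintegral; last first.
    exact: (integrable_quad mu2 (qc k k0)).
  congr EFin.
  have q1 := quad1_postw r y'.
  rewrite RintegralZr//; last first.
    apply: integrable_quad => //; apply: quadD; last exact: quad_cst.
    exact: quadZ.
  rewrite RintegralD//; last 2 first.
    by apply: integrable_quad => //; exact: quadZ.
    by apply: integrable_quad => //; exact: quad_cst.
  by rewrite RintegralZl ?Rint_cst//; exact: integrable_quad.
have mc k : (0 <= k)%R -> measurable_fun [set: B] (fun x : B => ((c x + k) * v)%:E).
  by move=> k0; apply/measurable_EFinP; exact: (qc k k0).1.
split.
  rewrite FE -intc//; apply: ge0_le_integral => //; first exact: mc.
  by move=> x _; exact: (near x).1.
have := intc 0%R (lexx _); rewrite addr0 => <-.
have -> : (th * v)%:E = \int[mu]_x (th * v)%:E.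
  by rewrite integral_cst// [X in _ * X]probability_setT mule1.
rewrite FE -ge0_integralD//; last first.
  by move=> x _; rewrite lee_fin mulr_ge0.
apply: ge0_le_integral => //.
- by move=> x _; rewrite lee_fin addr0 mulr_ge0.
- exact: mc.
- exact: emeasurable_funD.
- by move=> x _; rewrite addr0; exact: (near x).2.
Qed.

(* Both sides are limits of [mut (box y e) / (2 e)^d] as [e] tends to 0, which
   avoids a change of variables in the iterated integral. *)
Lemma ou_densityE y : (p y = g1 / sg ^+ d * evid mu (a / sg) (sg^-1 *: y))%R.
Proof.
have g10 : (0 < g1)%R by exact: gauss0_gt0.
have s0 : (0 < (sg ^+ d)^-1)%R by rewrite invr_gt0 exprn_gt0.
have pq : (g1 / sg ^+ d * evid mu (a / sg) (sg^-1 *: y) = q y * (sg ^+ d)^-1)%R.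
  by rewrite /q; ring.
rewrite pq.
suff H (th : R) : (0 < th)%R ->
    (`|p y - q y * (sg ^+ d)^-1| <= th * (1 + (sg ^+ d)^-1))%R.
  apply/eqP; rewrite -subr_eq0 -normr_eq0 eq_le normr_ge0 andbT.
  apply/ler_addgt0Pr => e e0; rewrite add0r.
  have c0 : (0 < 1 + (sg ^+ d)^-1)%R by rewrite addr_gt0.
  by apply: le_trans (H (e / (1 + (sg ^+ d)^-1))%R _) _;
    rewrite ?divr_gt0// divfK// gt_eqF.
move=> th0.
(* Continuity gives the identity at every y and not only almost everywhere, as the gradient of log p
   requires. *)
have [del del0 Hdel] := continuous_sqn (cp (x := y)) th0.
have D0 : (0 < d.+1%:R :> R)%R by rewrite ltr0n.
have K0 : (0 < g1 * (2 * d.+1%:R ^+ 2))%R by rewrite mulr_gt0// mulr_gt0// exprn_gt0.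
(* The three bounds keep the oscillation of p on the box below [th], the scaled half-width below 1,
   and the oscillation of the Gaussian below [th]. *)
pose e := Num.min (Num.sqrt (del / d.+1%:R))
  (Num.min sg (sg * (th / (g1 * (2 * d.+1%:R ^+ 2)))))%R.
have e0 : (0 < e)%R.
  by rewrite !lt_min sqrtr_gt0 sg0 divr_gt0//= mulr_gt0// divr_gt0.
have e1 : (e <= Num.sqrt (del / d.+1%:R))%R by rewrite /e ge_min lexx.
have e2 : (e <= sg)%R by rewrite /e !ge_min lexx !orbT.
have e3 : (g1 * (2 * d.+1%:R ^+ 2) * (e / sg) <= th)%R.
  have h : (e <= sg * (th / (g1 * (2 * d.+1%:R ^+ 2))))%R.
    by rewrite /e !ge_min lexx !orbT.
  rewrite -ler_pdivlMl// ler_pdivrMr// (le_trans h)// le_eqVlt.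
  by apply/orP; left; apply/eqP; rewrite [RHS]mulrC (mulrC th).
have Hbox x : box y e x -> (`|p x - p y| <= th)%R.
  move=> xb; apply/ltW/Hdel; apply: le_lt_trans (box_sqn_le (ltW e0) xb) _.
  have e2' : (e ^+ 2 <= del / d.+1%:R)%R.
    rewrite -[leRHS]sqr_sqrtr ?divr_ge0 ?(ltW del0)//.
    by rewrite ler_pXn2r ?nnegrE ?sqrtr_ge0// ltW.
  apply: (@le_lt_trans _ _ (d%:R * (del / d.+1%:R))%R).
    by rewrite ler_wpM2l.
  by rewrite mulrCA gtr_pMr// ltr_pdivrMr// mul1r ltr_nat.
have [] := mut_box_density e0 (ltW th0) Hbox.
have [] := mut_box_ou y e0 e2 (ltW th0) e3.
(* The ratio of the two box volumes is the Jacobian factor of the scaling. *)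
have -> : ((2 * (e / sg)) ^+ d = (2 * e) ^+ d * (sg ^+ d)^-1)%R.
  by rewrite mulrA exprMn exprVn.
have v0 : (0 < (2 * e) ^+ d)%R by rewrite exprn_gt0// mulr_gt0.
have mfin : mut (box y e) \is a fin_num by exact: fin_num_measure (measurable_box y e).
rewrite -(fineK mfin); move: (fine _) => m.
move: ((2 * e) ^+ d)%R v0 => v v0; move: (sg ^+ d)^-1%R s0 => s s0.
move: (q y) (p y) => Q P.
rewrite -!EFinD !lee_fin => h1 h2 h3 h4.
rewrite ler_distl; apply/andP; split.
  rewrite -(ler_pM2r v0) mulrBl lerBlDr; lra.
rewrite -(ler_pM2r v0); lra.
Qed.

End ou_density.

(** * Second moments of mu_t and of the loss under it *)

Section ou_moments.
Local Open Scope ereal_scope.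
Context {R : realType} {d : nat}.
Local Notation V := 'rV[R]_d.
Local Notation B := (Rd R d).
Variables (mu mut : probability B R) (p : V -> R) (a sg : R).
Hypothesis mu2 : \int[mu]_x (sqn x)%:E < +oo.
Hypothesis sg0 : (0 < sg)%R.
Hypothesis mutE : forall A : set B, measurable A -> mut A =
  \int[mu]_x leb_int (fun z => (gauss 1 z * \1_A (a *: (x : V) + sg *: z))%:E).
Hypothesis dp : is_density mut p.
Hypothesis cp : continuous p.

Let C0 : R := (gauss 1 (0 : V) * (4 * expR (d%:R / 4)))%R.

Let C0_ge0 : (0 <= C0)%R.
Proof. by rewrite mulr_ge0 ?gauss_ge0// mulr_ge0// expR_ge0. Qed.

(** The square |a x + sg z|^2 is at most 2 (a^2 + sg^2) (1 + |x|^2) (1 + |z|^2). The Gaussian times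
    1 + |z|^2 is below a multiple of [laplace], and the second moment of [mu] handles the rest. *)
Lemma ou_second_moment : \int[mut]_y (sqn y)%:E < +oo.
Proof.
have msq : measurable_fun [set: B] (fun y : B => (sqn (y : V))%:E : \bar R).
  by apply/measurable_EFinP; exact: measurable_sqn.
have sq0 (y : B) : 0 <= (sqn (y : V))%:E :> \bar R by rewrite lee_fin sqn_ge0.
apply: le_lt_trans (integral_le_ou mutE sq0 msq) _.
pose K : R := (2 * (a ^+ 2 + sg ^+ 2) * C0)%R.
have K0 : (0 <= K)%R by rewrite mulr_ge0// mulr_ge0// addr_ge0 ?sqr_ge0.
pose G (x : V) : R := (K * 4 ^+ d * (1 + sqn x))%R.
have qG : quad G.
  by apply: quadZ; apply: quadD; [exact: quad_cst|exact: quad_sqn].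
apply: (@le_lt_trans _ _ (\int[mu]_x (G x)%:E)); last first.
  by rewrite integral_EFin_Rintegral ?ltry//; exact: integrable_quad.
apply: ge0_le_integral => //.
- by move=> x _; apply: leb_int_ge0 => z; exact: ou_fun_ge0.
- exact: measurable_ou_leb.
- by apply/measurable_EFinP; exact: qG.1.
move=> x _.
have Kx0 : (0 <= K * (1 + sqn x))%R by rewrite mulr_ge0// addr_ge0// sqn_ge0.
have ml : measurable_fun [set: B] (fun z : B => (laplace (z : V))%:E : \bar R).
  by apply/measurable_EFinP; exact: measurable_laplace.
have l0 (z : B) : 0 <= (laplace (z : V))%:E :> \bar R by rewrite lee_fin expR_ge0.
apply: (@le_trans _ _ (leb_int (fun z : V => (K * (1 + sqn x))%:E * (laplace z)%:E))).
  apply: le_iter_leb => //.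
  - by move=> z; exact: ou_fun_ge0.
  - exact: measurable_ou_fun2.
  - exact: measurable_funeM.
  move=> z; rewrite /ou_fun/= -!EFinM lee_fin.
  apply: (@le_trans _ _ (2 * (a ^+ 2 + sg ^+ 2) * (1 + sqn x) *
     (gauss 1 z * (1 + sqn z)))%R).
    rewrite [leRHS]mulrCA ler_wpM2l ?gauss_ge0//.
    apply: le_trans (sqnD_le _ _) _; rewrite !sqnZ.
    have := sqn_ge0 x; have := sqn_ge0 z; have := sqr_ge0 a; have := sqr_ge0 sg.
    move: (a ^+ 2)%R (sg ^+ 2)%R (sqn x) (sqn z) => a2 s2 X Z s20 a20 Z0 X0.
    rewrite -subr_ge0 (_ : _ - _ = 2 * (a2 * (1 + Z + X * Z) + s2 * (1 + X + X * Z)))%R.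
      by rewrite mulr_ge0// addr_ge0// mulr_ge0// addr_ge0 ?mulr_ge0// addr_ge0.
    by ring.
  rewrite /K [(_ * C0 * _)%R]mulrAC -[leRHS]mulrA ler_wpM2l ?gauss_le_laplace//.
  by rewrite mulr_ge0 ?addr_ge0 ?sqn_ge0// mulr_ge0// addr_ge0 ?sqr_ge0.
rewrite /leb_int iter_lebZ// -/(leb_int _) leb_int_laplace -EFinM lee_fin /G.
by rewrite le_eqVlt; apply/orP; left; apply/eqP; ring.
Qed.

Let r := (a / sg)%R.

Definition scaled_loss (y : V) : R := loss mu r (sg^-1 *: y).

Lemma measurable_scale k : measurable_fun [set: B] ((fun y : V => k *: y)%R : B -> B).
Proof.
apply: measurable_fun_Rd => i; under eq_fun do rewrite mxE.
by apply: measurable_funM => //; exact: measurable_coord.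
Qed.

Lemma measurable_scaled_loss : measurable_fun [set: B] (scaled_loss : B -> R).
Proof. exact: measurableT_comp (measurable_loss r mu2) (measurable_scale _). Qed.

(* With [w = \sum_i `|y_i|], either [loss <= w] and the second moment applies,
   or the density is at most [c e^{- loss}] with [loss > w], and
   [loss^2 e^{- loss} <= 16 e^{- w / 2}] is Lebesgue-integrable. *)
Lemma ou_loss_sqr : \int[mut]_y (scaled_loss y ^+ 2)%:E < +oo.
Proof.
pose w (y : V) : R := (\sum_i `|y 0 i|)%R.
have mw : measurable_fun [set: B] (w : B -> R).
  apply: measurable_sum => i; apply: measurableT_comp => //.
  exact: measurable_coord.
have w2 y : (w y ^+ 2 <= d%:R * sqn y)%R.
  (* Cauchy-Schwarz against the vector of ones, whose squared norm is d. *)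
  pose u : V := \row_i `|y 0 i|%R; pose v : V := const_mx 1%R.
  have := dot_sqr_le u v.
  have -> : dot u v = w y by apply: eq_bigr => i _; rewrite !mxE mulr1.
  have -> : sqn u = sqn y.
    by apply: eq_bigr => i _; rewrite !mxE real_normK ?num_real.
  have -> : sqn v = d%:R.
    rewrite /sqn (eq_bigr (fun=> 1%R)) ?sumr_const ?card_ord// => i _.
    by rewrite mxE expr1n.
  by rewrite mulrC.
have w0 y : (0 <= w y)%R by apply: sumr_ge0.
have ml := measurable_scaled_loss.
have l0 y : (0 <= scaled_loss y)%R by exact: loss_ge0.
pose f2 (y : B) : R := if (w y < scaled_loss y)%R then (scaled_loss y ^+ 2)%R else 0%R.
have f20 y : (0 <= f2 y)%R by rewrite /f2; case: ifP => // _; exact: sqr_ge0.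
have mf2 : measurable_fun [set: B] f2.
  apply: measurable_fun_ifT => //; last exact: measurable_funX.
  exact: measurable_fun_ltr.
have msq : measurable_fun [set: B] (fun y : B => (sqn (y : V))%:E : \bar R).
  by apply/measurable_EFinP; exact: measurable_sqn.
have sq0 (y : B) : 0 <= (sqn (y : V))%:E :> \bar R by rewrite lee_fin sqn_ge0.
apply: (@le_lt_trans _ _ (\int[mut]_y (d%:R%:E * (sqn y)%:E + (f2 y)%:E))).
  apply: ge0_le_integral => //.
  - by move=> y _; rewrite lee_fin sqr_ge0.
  - by apply/measurable_EFinP; exact: measurable_funX.
  - apply: emeasurable_funD; first exact: measurable_funeM.
    by apply/measurable_EFinP.
  move=> y _; rewrite -EFinM -EFinD lee_fin /f2; case: ifPn => [_|].
    by rewrite lerDr mulr_ge0// sqn_ge0.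
  rewrite -leNgt addr0 => lw; apply: le_trans (w2 y).
  by rewrite ler_pXn2r ?nnegrE.
rewrite ge0_integralD//; last 4 first.
  by move=> y _; rewrite mule_ge0.
  exact: measurable_funeM.
  by move=> y _; rewrite lee_fin.
  by apply/measurable_EFinP.
apply: lte_add_pinfty.
  rewrite ge0_integralZl//; apply: lte_mul_pinfty => //.
  exact: ou_second_moment.
pose c : R := (gauss 1 (0 : V) / sg ^+ d)%R.
have c0 : (0 <= c)%R by rewrite divr_ge0 ?gauss_ge0// exprn_ge0// ltW.
apply: (@le_lt_trans _ _ (leb_int (fun y : V => (p y)%:E * (f2 y)%:E))).
  have mf2E : measurable_fun [set: B] (EFin \o f2) by apply/measurable_EFinP.
  have f2E0 (y : B) : 0 <= (EFin \o f2) y by rewrite /= lee_fin.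
  exact: (integral_le_density dp f2E0 mf2E).
have mlap : measurable_fun [set: B] (fun z : B => (laplace (z : V))%:E : \bar R).
  by apply/measurable_EFinP; exact: measurable_laplace.
have lap0 (z : B) : 0 <= (laplace (z : V))%:E :> \bar R by rewrite lee_fin expR_ge0.
apply: (@le_lt_trans _ _ (leb_int (fun y : V => (16 * c)%:E * (laplace y)%:E))).
  have [p0 [mp _]] := dp.
  apply: le_iter_leb => //.
  - by move=> y; rewrite -EFinM lee_fin mulr_ge0.
  - by apply: emeasurable_funM; by apply/measurable_EFinP.
  - exact: measurable_funeM.
  move=> y; rewrite -!EFinM lee_fin /f2; case: ifPn => [wl|_]; last first.
    by rewrite mulr0 mulr_ge0 ?expR_ge0// mulr_ge0.
  rewrite (ou_densityE mu2 sg0 mutE dp cp) -/c -/r.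
  have -> : evid mu r (sg^-1 *: y)%R = expR (- scaled_loss y).
    by rewrite /scaled_loss /loss opprK lnK// posrE evid_gt0.
  set l := scaled_loss y in wl *.
  have l0' : (0 <= l)%R by exact: l0.
  clearbody l.
  have e1 : (l ^+ 2 * expR (- l) <= 16 * expR (- l / 2))%R.
    (* From l / 4 <= e^(l / 4). The square of this gives 16 and spends half of the exponent; the
       other half stays for integrability. *)
    have e2 : (l * expR (- l / 4) <= 4)%R.
      rewrite mulNr expRN ler_pdivrMr ?expR_gt0//.
      by have := expR_ge1Dx (l / 4)%R; lra.
    have -> : (l ^+ 2 * expR (- l) = (l * expR (- l / 4)) ^+ 2 * expR (- l / 2))%R.
      have -> : (expR (- l) = expR (- l / 4) ^+ 2 * expR (- l / 2))%R.
        by rewrite -expRM_natl -expRD; congr expR; field.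
      by ring.
    rewrite ler_wpM2r ?expR_ge0// (_ : 16 = 4 ^+ 2)%R; last by ring.
    by rewrite ler_pXn2r ?nnegrE ?mulr_ge0 ?expR_ge0.
  have -> : (c * expR (- l) * l ^+ 2 = c * (l ^+ 2 * expR (- l)))%R by ring.
  have -> : (16 * c * laplace y = c * (16 * laplace y))%R by ring.
  rewrite ler_wpM2l// (le_trans e1)// ler_wpM2l// /laplace ler_expR -/(w y).
  by rewrite ler_wpM2r// lerN2 ltW.
have c16 : (0 <= 16 * c)%R by exact: mulr_ge0.
rewrite /leb_int iter_lebZ//.
by rewrite [iter_leb _ _ _]leb_int_laplace -EFinM ltry.
Qed.

End ou_moments.

(** * One backward step *)

Section layer_cake.
Local Open Scope ereal_scope.
Context {R : realType} dT {T : measurableType dT}.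

(** Tonelli's theorem for the indicator of c <= u < f x: in u it has the length of [[c, f x[], which
    is the positive part of f x - c, and in x it has the tail probability. *)
Lemma integral_layer_cake (P : probability T R) (f : T -> R) (c : R) :
  measurable_fun [set: T] f ->
  \int[P]_x (Num.max (f x - c) 0)%:E =
  \int[@lebesgue_measure R]_(u in [set u | (c <= u)%R]) P [set x | (u < f x)%R].
Proof.
move=> mf.
pose I (w : (T * R)%type) : \bar R :=
  if (c <= w.2)%R && (w.2 < f w.1)%R then 1 else 0.
have mI : measurable_fun [set: (T * R)%type] I.
  apply: measurable_fun_ifT; try exact: measurable_cst.
  have mf1 : measurable_fun [set: (T * R)%type] (fun w => f w.1).
    exact: measurableT_comp mf measurable_fst.
  by apply: measurable_and; [exact: measurable_fun_ler|exact: measurable_fun_ltr].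
have I0 w : 0 <= I w by rewrite /I; case: ifP.
transitivity (\int[P]_x \int[@lebesgue_measure R]_u I (x, u)).
  apply: eq_integral => x _.
  rewrite (_ : (fun u => I (x, u)) = fun u => (\1_`[c, f x[%classic u)%:E); last first.
    apply/funext => u; rewrite /I/= indicE.
    rewrite (_ : (u \in _) = (c <= u < f x)%R); first by case: ifP.
    by apply/idP/idP; rewrite inE /= in_itv.
  rewrite integral_indic// setIT.
  apply/esym; apply: etrans (lebesgue_measure_itv `[c, f x[) _ => /=.
  rewrite lte_fin; case: ltP => cf.
    by rewrite -EFinB max_l// subr_ge0 ltW.
  by rewrite max_r// subr_le0.
rewrite (@fubini_tonelli _ _ _ _ _ P (@lebesgue_measure R) I mI I0).
rewrite [RHS]integral_mkcond; apply: eq_integral => u _.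
rewrite patchE; case: ifPn; rewrite ?inE ?notin_setE/= => cu.
  rewrite (_ : (fun x => I (x, u)) = fun x => (\1_[set x | (u < f x)%R] x)%:E).
    rewrite integral_indic// ?setIT//.
    rewrite -[X in measurable X]setTI (_ : [set x | (u < f x)%R] =
      f @^-1` `]u, +oo[%classic); first exact: mf.
    by apply/seteqP; split => x /=; rewrite in_itv/= andbT.
  apply/funext => x; rewrite /I/= cu/= indicE.
  rewrite (_ : (x \in _) = (u < f x)%R); first by case: ifP.
  by apply/idP/idP; rewrite inE.
rewrite integral0_eq// => x _; rewrite /I/= ifF//.
by apply/negP => /andP[cu']; case: cu.
Qed.

End layer_cake.

(** * Increments of the drift *)

Section drift.
Context {R : realType} {d : nat}.
Local Notation V := 'rV[R]_d.
Local Notation B := (Rd R d).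
Variables (mu : probability B R) (r sg lam : R).
Hypothesis mu2 : (\int[mu]_x (sqn x)%:E < +oo)%E.
Hypothesis sg0 : 0 < sg.
Hypothesis lam0 : 0 < lam.

(* [bmap] moves [x] by [eta *: drift x], by Tweedie's formula. *)
Definition drift (x : V) : V :=
  x + lam *: (sg *: pmean mu r (sg^-1 *: x) - x).

Let dm (x h : V) : V :=
  pmean mu r (sg^-1 *: x + sg^-1 *: h) - pmean mu r (sg^-1 *: x).

Let driftB x h : drift (x + h) - drift x = (1 - lam) *: h + (lam * sg) *: dm x h.
Proof.
rewrite /drift /dm (scalerDr sg^-1).
move: (pmean mu r _) (pmean mu r (sg^-1 *: x)) => m1 m2.
apply/rowP => i; rewrite !mxE; ring.
Qed.

Let Lr_segment rho x h : 0 <= rho <= 1 -> sqn h <= rho * sg ^+ 2 ->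
  forall c, 0 <= c <= 1 ->
  Lr mu r (sg^-1 *: x + c *: (sg^-1 *: h)) <= Lsup mu r rho (sg^-1 *: x).
Proof.
move=> /andP[rho0 rho1] hr c /andP[c0 c1]; apply: Lr_le_Lsup => //.
have q0 : 0 <= sg^-1 ^+ 2 * sqn h by rewrite mulr_ge0 ?sqn_ge0// sqr_ge0.
rewrite !sqnZ (@le_trans _ _ (1 * (sg^-1 ^+ 2 * sqn h)))//.
  by rewrite ler_wpM2r// exprn_ile1.
by rewrite mul1r exprVn ler_pdivrMl ?exprn_gt0// mulrC.
Qed.

(** The factors sg and 1 / sg of the rescaling cancel, leaving lam L. This bound enters at first
    order in eta, so the sign of 1 - lam is kept; the norm bound below enters only at order eta^2
    and may lose it. *)
Lemma drift_dot_le rho x h : 0 <= rho <= 1 -> sqn h <= rho * sg ^+ 2 ->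
  dot h (drift (x + h) - drift x) <=
  (1 - lam + lam * Lsup mu r rho (sg^-1 *: x)) * sqn h.
Proof.
move=> rho01 hr; rewrite driftB dotDr !dotZr dotvv [leRHS]mulrDl lerD2l.
have := pmean_dot_le mu2 (Lr_segment x rho01 hr).
rewrite -/(dm x h) sqnZ dotZl => H.
have -> : lam * sg * dot h (dm x h) = lam * sg ^+ 2 * (sg^-1 * dot h (dm x h)).
  by field; rewrite gt_eqF.
apply: le_trans (ler_wpM2l _ H) _; first by rewrite mulr_ge0 ?sqr_ge0// ltW.
rewrite le_eqVlt; apply/orP; left; apply/eqP.
by field; rewrite gt_eqF.
Qed.

Lemma drift_enorm_le rho x h : 0 <= rho <= 1 -> sqn h <= rho * sg ^+ 2 ->
  enorm (drift (x + h) - drift x) <=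
  (1 + lam + lam * Lsup mu r rho (sg^-1 *: x)) * enorm h.
Proof.
move=> rho01 hr; rewrite driftB; apply: le_trans (enormD _ _) _.
rewrite [leRHS]mulrDl lerD// !enormZ.
  rewrite ler_wpM2r ?enorm_ge0// (le_trans (ler_normB _ _))// normr1.
  by rewrite gtr0_norm.
rewrite gtr0_norm ?mulr_gt0//.
have := pmean_enorm_le mu2 (Lr_segment x rho01 hr).
rewrite -/(dm x h) enormZ gtr0_norm ?invr_gt0// => H.
apply: le_trans (ler_wpM2l _ H) _; first by rewrite mulr_ge0 ?ltW.
rewrite le_eqVlt; apply/orP; left; apply/eqP.
by field; rewrite gt_eqF.
Qed.

End drift.

(** * Cost of the transported coupling *)

Section backward_step.
Context {R : realType} {d : nat}.
Local Notation V := 'rV[R]_d.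
Local Notation B := (Rd R d).
Variables (mu mut : probability B R) (r sg lam M delta : R).
Hypothesis mu2 : (\int[mu]_x (sqn x)%:E < +oo)%E.
Hypothesis sg0 : 0 < sg.
Hypothesis lam0 : 0 < lam.
Hypothesis M1 : 1 <= M.
Hypothesis delta01 : 0 < delta <= 1.

Let ell (y : V) : R := loss mu r (sg^-1 *: y).

Hypothesis ell2 : (\int[mut]_y (ell y ^+ 2)%:E < +oo)%E.

Let ell_ge0 y : 0 <= ell y. Proof. exact: loss_ge0. Qed.

Let measurable_ell : measurable_fun [set: B] (ell : B -> R).
Proof. exact: measurableT_comp (measurable_loss r mu2) (measurable_scale _). Qed.

Lemma integrable_loss_dominated (f : B -> R) (C : R) :
  measurable_fun [set: B] f -> 0 <= C ->
  (forall x : B, `|f x| <= C * (1 + ell x ^+ 2)) ->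
  mut.-integrable [set: B] (EFin \o f).
Proof.
move=> mf C0 fC.
apply: (@le_integrable _ _ _ mut setT _ _ (fun x : B => (C * (1 + ell x ^+ 2))%:E)) => //.
- by apply/measurable_EFinP.
- move=> x _ /=; rewrite lee_fin (le_trans (fC x))//.
  by rewrite ler_norm.
under eq_fun do rewrite EFinM EFinD.
apply: integrableZl => //; apply: integrableD => //.
  exact: finite_measure_integrable_cst.
apply/integrableP; split.
  by apply/measurable_EFinP; apply: measurable_funX; exact: measurable_ell.
by under eq_integral do rewrite gee0_abs ?lee_fin ?sqr_ge0//.
Qed.

Definition Lexcess (rho : R) (x : V) : R :=
  Num.max (Lsup mu r rho (sg^-1 *: x) - (1 - delta)) 0.

(** Bounds the squared local Lipschitz constant of the drift. With [envelope] in place of [Lsup] it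
    does not depend on [rho], so the second-order term has one fixed constant. *)
Definition Lsq (x : V) : R :=
  (1 + lam + lam * envelope mu r (sg^-1 *: x)) ^+ 2.

Lemma envelope_ge0 x : 0 <= envelope mu r (sg^-1 *: x).
Proof.
rewrite /envelope -/(ell x); have := ell_ge0 x; move: (ell x) => l l0.
by rewrite mulr_ge0 ?mulr_ge0 ?addr_ge0 ?mulr_ge0.
Qed.

Lemma Lexcess_ge0 rho x : 0 <= Lexcess rho x.
Proof. by rewrite le_max lexx orbT. Qed.

Lemma Lexcess_le_envelope rho x : 0 <= rho <= 1 ->
  Lexcess rho x <= envelope mu r (sg^-1 *: x).
Proof.
move=> rho01; rewrite ge_max envelope_ge0 andbT.
apply: le_trans (Lsup_le_envelope r mu2 (sg^-1 *: x) rho01).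
by rewrite gerBl subr_ge0; case/andP: delta01.
Qed.

Lemma measurable_envelope : measurable_fun [set: B]
  (fun x : B => envelope mu r (sg^-1 *: (x : V))).
Proof.
apply: measurable_funM => //; apply: measurable_funD => //.
exact: measurable_funM.
Qed.

Lemma envelope_le_loss_sqr x : envelope mu r (sg^-1 *: x) <= 8 * d%:R * (1 + ell x ^+ 2).
Proof.
rewrite /envelope -/(ell x); have := sqr_ge0 (1 - ell x).
have : 0 <= d%:R :> R by [].
move: (ell x) (d%:R : R) => l D D0; rewrite sqrrB expr1n => h.
have -> : 8 * D * (1 + l ^+ 2) = 4 * D * (2 * (1 + l ^+ 2)) by ring.
by rewrite ler_wpM2l ?mulr_ge0//; have := sqr_ge0 l; lra.
Qed.

Lemma integrable_envelope : mut.-integrable [set: B]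
  (EFin \o (fun x : B => envelope mu r (sg^-1 *: (x : V)))).
Proof.
apply: (integrable_loss_dominated (C := 8 * d%:R)).
- exact: measurable_envelope.
- exact: mulr_ge0.
by move=> x; rewrite ger0_norm ?envelope_ge0//; exact: envelope_le_loss_sqr.
Qed.

Lemma measurable_Lexcess rho : 0 <= rho <= 1 ->
  measurable_fun [set: B] (Lexcess rho : B -> R).
Proof.
move=> rho01; apply: measurable_maxr => //; apply: measurable_funB => //.
exact: measurableT_comp (measurable_Lsup r mu2 rho01) (measurable_scale _).
Qed.

Lemma integrable_Lexcess rho : 0 <= rho <= 1 ->
  mut.-integrable [set: B] (EFin \o (Lexcess rho : B -> R)).
Proof.
move=> rho01; apply: (integrable_loss_dominated (C := 8 * d%:R)).
- exact: measurable_Lexcess.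
- exact: mulr_ge0.
move=> x; rewrite ger0_norm ?Lexcess_ge0//.
by apply: le_trans (Lexcess_le_envelope _ rho01) (envelope_le_loss_sqr _).
Qed.

Let measurable_Lsq : measurable_fun [set: B] (Lsq : B -> R).
Proof.
apply: measurable_funX; apply: measurable_funD => //.
by apply: measurable_funM => //; exact: measurable_envelope.
Qed.

Lemma integrable_Lsq : mut.-integrable [set: B] (EFin \o (Lsq : B -> R)).
Proof.
(* From (a + b)^2 <= 2 a^2 + 2 b^2 and (1 + 2 l)^2 <= 8 (1 + l^2). *)
pose C : R := 2 * (1 + lam) ^+ 2 + 2 * lam ^+ 2 * (16 * d%:R ^+ 2) * 8.
have D2 : 0 <= d%:R ^+ 2 :> R by exact: sqr_ge0.
apply: (integrable_loss_dominated (C := C)) => //.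
  rewrite /C; move: (sqr_ge0 (1 + lam)) (sqr_ge0 lam) D2.
  move: ((1 + lam) ^+ 2) (lam ^+ 2) (d%:R ^+ 2 : R) => A1 A2 A3 A10 A20 A30.
  by rewrite addr_ge0 ?mulr_ge0 ?mulr_ge0 ?mulr_ge0.
move=> x; rewrite ger0_norm ?sqr_ge0// /Lsq /envelope -/(ell x) /C.
move: (ell x) => l.
rewrite -subr_ge0.
rewrite (_ : _ - _ = (1 + lam - lam * (4 * d%:R * (1 + 2 * l))) ^+ 2
  + 2 * (1 + lam) ^+ 2 * l ^+ 2
  + 2 * lam ^+ 2 * (16 * d%:R ^+ 2) * (7 + 4 * l ^+ 2 - 4 * l)); last by ring.
have l7 : 0 <= 7 + 4 * l ^+ 2 - 4 * l.
  by have := sqr_ge0 (2 * l - 1); rewrite sqrrB expr1n exprMn; lra.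
move: (7 + 4 * l ^+ 2 - 4 * l) l7 (sqr_ge0 (1 + lam)) (sqr_ge0 lam) D2 => l7.
move: (sqr_ge0 (1 + lam - lam * (4 * d%:R * (1 + 2 * l)))) (sqr_ge0 l).
move: ((1 + lam - _) ^+ 2) ((1 + lam) ^+ 2) (l ^+ 2) (lam ^+ 2) (d%:R ^+ 2 : R).
move=> A0 A1 A2 A3 A4 *.
by rewrite addr_ge0 ?addr_ge0 ?mulr_ge0 ?mulr_ge0 ?mulr_ge0.
Qed.

Let F rho : R := \int[mut]_x Lexcess rho x.
Let G : R := \int[mut]_x Lsq x.

Definition bstep (eta : R) (x : V) : V := x + eta *: drift mu r sg lam x.

Lemma measurable_bstep eta : measurable_fun [set: B] (bstep eta : B -> B).
Proof.
have mpm := measurableT_comp (measurable_pmean r mu2) (@measurable_scale _ d sg^-1).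
apply: measurable_fun_Rd => i.
rewrite (_ : (fun x => _) = fun x : B => (x : V) 0 i + eta * ((x : V) 0 i
    + lam * (sg * pmean mu r (sg^-1 *: (x : V)) 0 i - (x : V) 0 i))); last first.
  apply/funext => x; rewrite /bstep /drift.
  by move: (pmean mu r _) => m; rewrite !mxE.
have mi := @measurable_coord R d i.
apply: measurable_funD => //; apply: measurable_funM => //.
apply: measurable_funD => //; apply: measurable_funM => //.
apply: measurable_funB => //; apply: measurable_funM => //.
exact: (measurableT_comp mi mpm).
Qed.

(** The square |h + eta v|^2 is expanded, with v the increment of the drift. The rate is kept apart
    from the excess because the two are integrated differently. *)
Lemma bstep_sqn_le eta rho x h : 0 <= eta -> 0 <= rho <= 1 ->
  sqn h <= rho * sg ^+ 2 ->
  sqn (bstep eta x - bstep eta (x + h)) <=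
  (1 + 2 * eta * (1 - lam * delta)) * sqn h
  + sqn h * (2 * eta * lam * Lexcess rho x + eta ^+ 2 * Lsq x).
Proof.
move=> eta0 rho01 hr; rewrite sqnBC.
have -> : bstep eta (x + h) - bstep eta x =
    h + eta *: (drift mu r sg lam (x + h) - drift mu r sg lam x).
  rewrite /bstep; move: (drift mu r sg lam _) (drift mu r sg lam x) => v1 v2.
  by apply/rowP => i; rewrite !mxE; ring.
have h1 := drift_dot_le r mu2 sg0 lam0 x rho01 hr.
have h2 := drift_enorm_le r mu2 sg0 lam0 x rho01 hr.
set v := drift mu r sg lam (x + h) - drift mu r sg lam x in h1 h2 *.
rewrite sqnD sqnZ dotZr.
have S0 := Lsup_ge0 r mu2 (sg^-1 *: x) rho01.
have SE := Lsup_le_envelope r mu2 (sg^-1 *: x) rho01.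
have Fx : Lsup mu r rho (sg^-1 *: x) <= Lexcess rho x + (1 - delta).
  by rewrite -lerBlDr le_max lexx.
have env0 : 0 <= 1 + lam + lam * envelope mu r (sg^-1 *: x).
  have l0 := ltW lam0.
  apply: addr_ge0; [exact: addr_ge0|exact: (mulr_ge0 l0 (envelope_ge0 x))].
have v2 : sqn v <= Lsq x * sqn h.
  rewrite -!enorm_sqr /Lsq -exprMn.
  rewrite ler_pXn2r ?nnegrE ?enorm_ge0//; last first.
    exact: (mulr_ge0 env0 (enorm_ge0 h)).
  apply: le_trans h2 _; rewrite ler_wpM2r ?enorm_ge0// lerD2l.
  by rewrite ler_wpM2l// ltW.
have v1 : dot h v <= (1 - lam * delta + lam * Lexcess rho x) * sqn h.
  apply: le_trans h1 _; rewrite ler_wpM2r ?sqn_ge0//.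
  have := ler_wpM2l (ltW lam0) Fx; rewrite mulrDr mulrBr mulr1.
  move: (lam * Lsup _ _ _ _) (lam * Lexcess _ _) (lam * delta) => A1 A2 A3.
  lra.
have e1 := ler_wpM2l eta0 v1.
have e2 := ler_wpM2l (sqr_ge0 eta) v2.
move: e1 e2; move: (dot h v) (sqn v) (Lexcess rho x) (Lsq x) (sqn h).
move=> dv sv Fv Gv sh e1 e2.
apply: (@le_trans _ _ (sh + 2 * (eta * ((1 - lam * delta + lam * Fv) * sh))
   + eta ^+ 2 * (Gv * sh))); first lra.
rewrite le_eqVlt; apply/orP; left; apply/eqP; ring.
Qed.

(** The constant rate integrates against the displacement to exactly [w]; in the remainder the
    displacement is first replaced by its bound [M * w], which leaves integrals independent of
    [nu]. *)
Lemma W2sq_push_le (nu : probability B R) (T : V -> V) eta rho w :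
  measurable_fun [set: B] (T : B -> B) ->
  (forall A : set B, measurable A -> nu A = mut (T @^-1` A)) ->
  (\int[mut]_x (sqn (T x - x))%:E)%E = w%:E ->
  {ae mut, forall x : B, ((sqn (T x - x))%:E <= M%:E * w%:E)%E} ->
  0 <= w -> 0 <= eta -> 0 <= rho <= 1 -> M * w <= rho * sg ^+ 2 ->
  0 <= 1 + 2 * eta * (1 - lam * delta) ->
  (W2sq (push (bstep eta) mut) (push (bstep eta) nu) <=
  ((1 + 2 * eta * (1 - lam * delta)) * w
    + M * w * (2 * eta * lam * F rho + eta ^+ 2 * G))%:E)%E.
Proof.
move=> mT nuE Tw Tsup w0 eta0 rho01 Mw kap0.
have M0 : 0 <= M by exact: le_trans M1.
set kap := 1 + 2 * eta * _ in kap0 *.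
have mb := measurable_bstep eta.
have mbT := measurableT_comp mb mT.
pose X0 (x : B) : (B * B)%type := (bstep eta x : B, bstep eta (T x) : B).
have mX0 : measurable_fun [set: B] X0 by exact: measurable_fun_pair.
pose X : {mfun B >-> (B * B)%type} := mfun_Sub (mem_set mX0).
pose g : probability (B * B)%type R := distribution mut X.
have gc : coupling (push (bstep eta) mut) (push (bstep eta) nu) g.
  move=> A mA; split.
    rewrite /g /distribution /pushforward /push; congr (mut _).
    by apply/seteqP; split => x /=; [case|].
  rewrite /push nuE; last by rewrite -[X in measurable X]setTI; exact: mb.
  rewrite /g /distribution /pushforward; congr (mut _).
  by apply/seteqP; split => x /=; [case|].
apply: le_trans (ereal_inf_lbound _) _; first by exists g.
have mcost : measurable_fun [set: (B * B)%type]
    (fun z : (B * B)%type => (sqn ((z.1 : V) - (z.2 : V)))%:E : \bar R).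
  apply/measurable_EFinP; apply: (measurableT_comp (@measurable_sqn R d)).
  have := @measurable_affine R d 1 (-1).
  by under eq_fun do rewrite scale1r scaleN1r.
rewrite ge0_integral_distribution//; last by move=> z; rewrite lee_fin sqn_ge0.
pose f (x : B) : R := M * w * (2 * eta * lam * Lexcess rho x + eta ^+ 2 * Lsq x).
have mTx : measurable_fun [set: B] (fun x : B => sqn (T x - x)).
  apply: (measurableT_comp (@measurable_sqn R d)).
  have := measurableT_comp (@measurable_affine R d 1 (-1))
    (measurable_fun_pair mT (@measurable_id _ B setT)).
  by rewrite /comp/=; under eq_fun do rewrite scale1r scaleN1r.
have f0 x : 0 <= f x.
  rewrite mulr_ge0 ?mulr_ge0// addr_ge0//.
    by rewrite !mulr_ge0 ?Lexcess_ge0// ltW.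
  by rewrite mulr_ge0 ?sqr_ge0.
have mf : measurable_fun [set: B] f.
  apply: measurable_funM => //; apply: measurable_funD.
    by apply: measurable_funM => //; exact: measurable_Lexcess.
  exact: measurable_funM.
have iF := integrable_Lexcess rho01.
have iG := integrable_Lsq.
have iFZ c : mut.-integrable [set: B] (EFin \o (fun x : B => c * Lexcess rho x)).
  by rewrite /comp; under eq_fun do rewrite EFinM; exact: integrableZl.
have iGZ c : mut.-integrable [set: B] (EFin \o (fun x : B => c * Lsq x)).
  by rewrite /comp; under eq_fun do rewrite EFinM; exact: integrableZl.
have iFG : mut.-integrable [set: B]
    (EFin \o (fun x : B => 2 * eta * lam * Lexcess rho x + eta ^+ 2 * Lsq x)).
  exact: (integrableD measurableT (iFZ (2 * eta * lam)) (iGZ (eta ^+ 2))).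
have iff : mut.-integrable [set: B] (EFin \o f).
  exact: (integrableZl measurableT (M * w) iFG).
have fE : (\int[mut]_x (f x)%:E)%E =
    (M * w * (2 * eta * lam * F rho + eta ^+ 2 * G))%:E.
  rewrite integral_EFin_Rintegral//; congr EFin.
  by rewrite RintegralZl// RintegralD// !RintegralZl.
apply: (@le_trans _ _ (\int[mut]_x (kap%:E * (sqn (T x - x))%:E + (f x)%:E))%E).
  have mk : measurable_fun [set: B] (fun x : B => kap%:E * (sqn (T x - x))%:E)%E.
    by apply: measurable_funeM; apply/measurable_EFinP.
  apply: ae_ge0_le_integral => //.
  - by move=> x _ /=; rewrite lee_fin sqn_ge0.
  - exact: (measurableT_comp mcost mX0).
  - by move=> x _; rewrite adde_ge0 ?mule_ge0 ?lee_fin ?sqn_ge0.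
  - by apply: emeasurable_funD => //; apply/measurable_EFinP.
  (* The bound [hx] serves twice: with [Mw] it puts T x within the squared radius rho sg^2 of x, and
     it replaces the squared displacement in front of the excess. *)
  apply: filterS Tsup => x; rewrite -!EFinM lee_fin => hx _ /=.
  have := @bstep_sqn_le eta rho x (T x - x) eta0 rho01 (le_trans hx Mw).
  rewrite [x + (T x - x)]addrC subrK -EFinD lee_fin => H.
  apply: le_trans H _; rewrite lerD2l /f ler_wpM2r// addr_ge0//.
    by rewrite !mulr_ge0 ?Lexcess_ge0// ltW.
  by rewrite mulr_ge0 ?sqr_ge0.
rewrite ge0_integralD//; last 4 first.
  by move=> x _; rewrite mule_ge0 ?lee_fin ?sqn_ge0.
  by apply: measurable_funeM; apply/measurable_EFinP.
  by move=> x _; rewrite lee_fin.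
  by apply/measurable_EFinP.
rewrite ge0_integralZl//; last 2 first.
  by apply/measurable_EFinP.
  by move=> x _; rewrite lee_fin sqn_ge0.
by rewrite Tw fE -EFinM -EFinD.
Qed.

End backward_step.

(** * The iterated upper limit *)

Section limsup.
Context {R : realType} {d : nat}.
Local Notation V := 'rV[R]_d.
Local Notation B := (Rd R d).
Variables (mu mut : probability B R) (r sg lam M delta : R).
Hypothesis mu2 : (\int[mu]_x (sqn x)%:E < +oo)%E.
Hypothesis sg0 : 0 < sg.
Hypothesis lam0 : 0 < lam.
Hypothesis M1 : 1 <= M.
Hypothesis delta01 : 0 < delta <= 1.
Hypothesis ell2 :
  (\int[mut]_y (loss mu r (sg^-1 *: (y : V)) ^+ 2)%:E < +oo)%E.

Let F rho : R := \int[mut]_x Lexcess mu r sg delta rho x.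
Let G : R := \int[mut]_x Lsq mu r sg lam x.
Let b := bstep mu r sg lam.

(** Division by [eta * w] removes [w] entirely, so the bound is uniform over all [nu] close enough
    that M W_2^2 stays below the squared radius. *)
Lemma ratio_le (nu : probability B R) eta rho :
  0 < eta -> 0 <= rho <= 1 -> 0 <= 1 + 2 * eta * (1 - lam * delta) ->
  Mset mut M nu -> (0 < W2sq mut nu < (rho * sg ^+ 2 / M)%:E)%E ->
  (Defs.ratio (b eta) eta mut nu <=
    (2 * (1 - lam * delta) + M * (2 * lam * F rho + eta * G))%:E)%E.
Proof.
move=> eta0 rho01 kap0 [_ [T [mT [nuE [Tw Tsup]]]]] /andP[w0 wrho].
have M0 : 0 < M by exact: lt_le_trans M1.
move: w0 wrho Tw Tsup; rewrite /Defs.ratio.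
(* The squared distance lies between 0 and a real number, so it is finite and [fine] returns its
   value. *)
case: (W2sq mut nu) => [w| |] //.
rewrite !lte_fin => w0 wrho Tw Tsup.
have Mw : M * w <= rho * sg ^+ 2.
  by rewrite mulrC -ler_pdivlMr// ltW.
have H := W2sq_push_le mu2 sg0 lam0 M1 delta01 ell2 mT nuE Tw Tsup (ltW w0)
  (ltW eta0) rho01 Mw kap0.
have i0 : 0 < (eta * w)^-1 by rewrite invr_gt0 mulr_gt0.
apply: le_trans (lee_wpmul2r _ (leeB H (lexx w%:E))) _.
  by rewrite lee_fin ltW.
rewrite -EFinB -EFinM lee_fin -/(F rho) -/G.
move: (F rho) G => A C.
rewrite le_eqVlt; apply/orP; left; apply/eqP; rewrite [fine _]/=; field.
by rewrite !gt_eqF.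
Qed.

Lemma inner_limsup_le eta rho :
  0 < eta -> 0 < rho <= 1 -> 0 <= 1 + 2 * eta * (1 - lam * delta) ->
  (inner_limsup (b eta) eta mut M <=
    (2 * (1 - lam * delta) + M * (2 * lam * F rho + eta * G))%:E)%E.
Proof.
move=> eta0 /andP[rho0 rho1] kap0.
have M0 : 0 < M by exact: lt_le_trans M1.
apply: le_trans (ereal_inf_lbound _) _.
  exists (rho * sg ^+ 2 / M) => //=.
  by rewrite divr_gt0// mulr_gt0// exprn_gt0.
apply: ge_ereal_sup => _ [nu /= [Mnu wnu] <-].
by apply: ratio_le => //; rewrite (ltW rho0).
Qed.

Definition Lexcess0 (x : V) : R :=
  Num.max (Lr mu r (sg^-1 *: x) - (1 - delta)) 0.

Let rho n : R := n.+1%:R^-1.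

Let rho01 n : 0 < rho n <= 1.
Proof. by rewrite invr_gt0 ltr0n/= invf_le1 ?ler1n. Qed.

Let rho01' n : 0 <= rho n <= 1.
Proof. by have /andP[/ltW -> ->] := rho01 n. Qed.

Let maxr0_dist (a c : R) : `|Num.max a 0 - Num.max c 0| <= `|a - c|.
Proof.
case: (leP a 0) => a0; case: (leP c 0) => c0; rewrite ?subrr ?normr0//.
  rewrite sub0r normrN gtr0_norm// distrC ler_normr; apply/orP; left.
  by rewrite lerBrDl gerDr.
rewrite subr0 gtr0_norm// ler_normr; apply/orP; left.
by rewrite lerBrDl gerDr.
Qed.

Let Lexcess_cvg : mut.-integrable [set: B] (EFin \o (Lexcess0 : B -> R)) /\
  (\int[mut]_x (Lexcess mu r sg delta (rho n) x)%:E @[n --> \oo]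
    --> \int[mut]_x (Lexcess0 x)%:E)%E.
Proof.
have mL0 : measurable_fun [set: B] (Lexcess0 : B -> R).
  apply: measurable_maxr => //; apply: measurable_funB => //.
  exact: measurableT_comp (measurable_Lr r mu2) (measurable_scale _).
have iL n := integrable_Lexcess mu2 delta01 ell2 (rho01' n).
have [] := @dominated_convergence _ B R mut setT measurableT
  (fun n x => (Lexcess mu r sg delta (rho n) x)%:E)
  (fun x => (Lexcess0 x)%:E)
  (fun x => (envelope mu r (sg^-1 *: (x : V)))%:E).
- by move=> n; case/integrableP: (iL n).
- by apply/measurable_EFinP.
- apply: aeW => x _; apply: cvg_EFin; first exact: nearW.
  apply/cvgrPdist_le => e e0.
  have /cvgrPdist_le/(_ e e0) := @cvg_Lsup R d mu r mu2 (sg^-1 *: (x : V)).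
  apply: filterS => n; apply: le_trans; rewrite /Lexcess0 /Lexcess.
  apply: le_trans (maxr0_dist _ _) _.
  have sub3 (u v w : R) : u - w - (v - w) = u - v by ring.
  by rewrite sub3.
- exact: (integrable_envelope mu2 ell2).
- apply: aeW => x n _; rewrite gee0_abs lee_fin ?Lexcess_ge0//.
  exact: (Lexcess_le_envelope r sg mu2 delta01 x (rho01' n)).
by move=> h1 _ h2; split.
Qed.

(** The inner upper limit allows every positive [rho], whatever eta is. Hence [rho] is fixed first,
    to bring the excess near its limit, and eta afterwards, to make the second-order term small. *)
Lemma eta_limsup_le :
  (eta_limsup (fun eta => inner_limsup (b eta) eta mut M) <=
   (2 * (1 - lam * delta))%:E
     + (2 * lam * M)%:E * \int[mut]_x (Lexcess0 x)%:E)%E.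
Proof.
have M0 : 0 < M by exact: lt_le_trans M1.
have [iL0 cL] := Lexcess_cvg.
rewrite integral_EFin_Rintegral// in cL *.
set L0 : R := \int[mut]_x Lexcess0 x in cL *.
rewrite -EFinM -EFinD.
apply/lee_addgt0Pr => e e0.
(* Multiplied by the coefficient 2 lam M, this error becomes e / 2. *)
have e1 : 0 < e / (4 * lam * M) by rewrite divr_gt0// !mulr_gt0.
have [n Fn] : exists n, F (rho n) <= L0 + e / (4 * lam * M).
  move/fine_cvgP: cL => [_ /cvgrPdist_le/(_ _ e1)[N _ HN]].
  exists N; have := HN N (leqnn N); rewrite /= distrC ler_norml => /andP[_].
  by rewrite lerBlDl.
have G0 : 0 <= G by apply: Rintegral_ge0 => x _; exact: sqr_ge0.
have MG : 0 < 2 * (M * G + 1) by rewrite mulr_gt0// ltr_wpDl// mulr_ge0// ltW.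
have l2 : 0 < 2 * lam by rewrite mulr_gt0.
(* The first bound leaves at most e / 2 for the term eta M G, the added 1 guarding against G = 0;
   the second keeps the factor 1 + 2 eta (1 - lam delta) nonnegative. *)
pose eps := Num.min (e / (2 * (M * G + 1))) (2 * lam)^-1.
apply: le_trans (ereal_inf_lbound _) _.
  exists eps => //=.
  by rewrite lt_min divr_gt0// invr_gt0.
apply: ge_ereal_sup => _ [eta /= /andP[eta0 etae] <-].
move: etae; rewrite lt_min => /andP[eta1 eta2].
have kap0 : 0 <= 1 + 2 * eta * (1 - lam * delta).
  have h1 : eta * (2 * lam) <= 1.
    by rewrite -ler_pdivlMr// mul1r ltW.
  have h2 : eta * (2 * lam) * delta <= 1.
    have /andP[d0 d1] := delta01.
    by apply: mulr_ile1 => //; [exact: (mulr_ge0 (ltW eta0) (ltW l2))|exact: ltW].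
  by rewrite mulrBr mulr1; lra.
apply: le_trans (inner_limsup_le eta0 (rho01 n) kap0) _.
rewrite lee_fin.
have h3 : eta * (M * G) <= e / 2.
  have : eta * (2 * (M * G + 1)) <= e by rewrite -ler_pdivlMr// ltW.
  by move: (M * G) => MG'; lra.
have h4 : 2 * lam * M * F (rho n) <= 2 * lam * M * L0 + e / 2.
  have -> : e / 2 = 2 * lam * M * (e / (4 * lam * M)).
    by field; rewrite !gt_eqF.
  by rewrite -mulrDr ler_wpM2l// ltW// !mulr_gt0.
move: (F (rho n)) h4 G h3 => A h4 C h3.
rewrite (_ : M * _ = 2 * lam * M * A + eta * (M * C)); last by ring.
by move: (2 * lam * M * A) (eta * (M * C)) (2 * lam * M * L0) h3 h4 => *; lra.
Qed.

End limsup.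

(** * The parameters of the Ornstein-Uhlenbeck process, and the conclusion *)

Lemma indic_comp {R : realType} (S T : Type) (Q : T -> Prop) (k : S -> T) (w : S) :
  \1_[set y | Q (k y)] w = \1_[set y | Q y] (k w) :> R.
Proof. by rewrite !indicE; congr ((_ : bool)%:R); apply/idP/idP; rewrite !inE. Qed.

Theorem mainTheorem11 (R : realType) (d : nat) (beta : R)
    (mu : probability (Rd R d) R) (t : R)
    (mut : probability (Rd R d) R) (p : 'rV[R]_d -> R) (M delta : R) :
  0 < beta ->
  P2r mu ->
  0 < t ->
  (* mu_t is the law of X_t = e^{-t} X_0 + sqrt(beta^-1 (1 - e^{-2t})) Z *)
  (forall A : set (Rd R d), measurable A -> mut A = OU_law beta t mu A) ->
  (* p = p_{mu_t} is the (continuous version of the) density of mu_t *)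
  is_density mut p -> continuous p ->
  1 <= M ->
  0 < delta <= 1 ->
  (eta_limsup (fun eta => inner_limsup (bmap beta p eta) eta mut M)
   <= (2 - 2 / (1 - expR (- (2 * t)))
             * delta)%:E
      + (2 / (1 - expR (- (2 * t))) * M)%:E * h_mu mu delta (snr beta t))%E.
Proof.
move=> beta0 [_ mu2] t0 mutE dp cp M1 delta01.
set E := expR (- (2 * t)).
have E1 : 0 < 1 - E by rewrite subr_gt0 expR_lt1 oppr_lt0 mulr_gt0.
have bE : 0 < beta^-1 * (1 - E) by rewrite mulr_gt0// invr_gt0.
pose sg := Num.sqrt (beta^-1 * (1 - E)).
have sg0 : 0 < sg by rewrite sqrtr_gt0.
have sg2 : sg ^+ 2 = beta^-1 * (1 - E) by rewrite sqr_sqrtr// ltW.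
pose lam := (1 - E)^-1.
have lam0 : 0 < lam by rewrite invr_gt0.
pose r := snr beta t.
have rE : r = expR (- t) / sg by [].
have ell2 : (\int[mut]_y (loss mu r (sg^-1 *: (y : 'rV[R]_d)) ^+ 2)%:E < +oo)%E.
  exact: (ou_loss_sqr mu2 sg0 mutE dp cp).
have bmapE eta : bmap beta p eta = bstep mu r sg lam eta.
  apply/funext => x; rewrite /bmap.
  have c0 : 0 < gauss 1 (0 : 'rV[R]_d) / sg ^+ d.
    by rewrite divr_gt0 ?gauss0_gt0// exprn_gt0.
  rewrite (grad_ln_evid mu2 x c0 (ou_densityE mu2 sg0 mutE dp cp)).
  rewrite /bstep /drift -/r; congr (_ + _ *: (_ + _)).
  (* This turns beta^-1 times the score sg^-1 (m - x / sg) into lam (sg m - x), the form used in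
     [drift]. *)
  have -> : beta^-1 = lam * sg ^+ 2.
    by rewrite sg2 /lam mulrCA mulVf ?mulr1// gt_eqF.
  rewrite scalerA -mulrA expr2 mulfK ?gt_eqF// -scalerA; congr (_ *: _).
  by rewrite scalerBr scalerA divff ?scale1r// gt_eqF.
have -> : (fun eta => inner_limsup (bmap beta p eta) eta mut M) =
    (fun eta => inner_limsup (bstep mu r sg lam eta) eta mut M).
  by apply/funext => eta; rewrite bmapE.
apply: le_trans (eta_limsup_le mu2 sg0 lam0 M1 delta01 ell2) _.
have -> : 2 - 2 / (1 - E) * delta = 2 * (1 - lam * delta).
  by rewrite /lam; ring.
rewrite leeD2l// /lam mulrAC -/lam.
rewrite lee_wpmul2l//.
  by rewrite lee_fin !mulr_ge0 ?(ltW lam0)// (le_trans _ M1).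
rewrite integral_layer_cake; last first.
  exact: measurableT_comp (measurable_Lr r mu2) (measurable_scale _).
rewrite le_eqVlt; apply/orP; left; apply/eqP; apply: eq_integral => u _.
have mlev : measurable ([set y | u < Lr mu r (sg^-1 *: y)] : set (Rd R d)).
  have mL := measurableT_comp (measurable_Lr r mu2) (@measurable_scale R d sg^-1).
  rewrite -[X in measurable X]setTI (_ : [set y | _] =
    (fun y : Rd R d => Lr mu r (sg^-1 *: (y : 'rV[R]_d))) @^-1` `]u, +oo[%classic).
    exact: mL.
  by apply/seteqP; split => y /=; rewrite in_itv/= andbT.
rewrite [LHS](mutE _ mlev) /OU_law /s_r -/E -/sg.
(* Dividing X_t by sg gives the channel output r X + Z, so the tail of L(y / sg) under mu_t is
   [s_r]. *)
have yE (x z : 'rV[R]_d) : sg^-1 *: (expR (- t) *: x + sg *: z) = r *: x + z.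
  by rewrite scalerDr !scalerA mulVf ?gt_eqF// scale1r mulrC rE.
apply: eq_integral => x _.
apply: (congr1 leb_int).
apply/funext => z.
apply: (congr1 (fun i : R => (gauss 1 z * i)%:E)).
rewrite -(yE x z).
exact: (indic_comp (fun y => u < Lr mu r y) (fun y : 'rV[R]_d => sg^-1 *: y)
  (expR (- t) *: (x : 'rV[R]_d) + sg *: z)).
Qed.
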